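(* Let $\mu$ be a shift-invariant probability measure on $A^{\mathbb{Z}}$ compatible with a probability kernel $g$ satisfying $\Delta(g)>0$. Then, for all $f\in\mathcal{L}$ and all $\theta\in\mathbb{R}$, $$\mathbb{E}_{\mu}\left[e^{\theta(f-\mathbb{E}_{\mu}[f])}\right]\le \exp\left(\frac{\theta^2\,\Delta(g)^{-2}}{8}\,\|\underline{\delta}(f)\|_2^2\right),$$ and, for all $u>0$, $$\mu\left(\left|f-\mathbb{E}_{\mu}[f]\right|>u\right)\le 2\exp\left(-\frac{2u^2}{\Delta(g)^{-2}\,\|\underline{\delta}(f)\|_2^2}\right).$$
   Context: $A$ is a countable set with the discrete topology; $A^{\mathbb{Z}}$ has the product topology and the $\sigma$-algebra generated by cylinders; the shift is $(T\omega)_i=\omega_{i+1}$, and $\mu$ is shift-invariant if $\mu\circ T^{-1}=\mu$. For integers $i\le j$, $\omega_i^j=(\omega_i,\dots,\omega_j)$ (the empty string if $i>j$). $\mathcal{X}^-=A^{\{\dots,-2,-1\}}$. A probability kernel is a function $g:A\times\mathcal{X}^-\to[0,1]$ with $\sum_{s\in A}g(s|x)=1$ for all $x\in\mathcal{X}^-$; for a left-infinite sequence ending at another index $n-1$, $g(\cdot|\cdot)$ denotes the same function after re-indexing (kernels are shift-invariant). A probability measure $\mu$ on $A^{\mathbb{Z}}$ is compatible with $g$ if for all $n\in\mathbb{Z}$, $a\in A$, and $\mu$-a.e. past $x=(\dots,x_{n-2},x_{n-1})$, the conditional probability under $\mu$ that the $n$-th coordinate equals $a$ given the $\sigma$-algebra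 $\mathcal{F}_{-\infty}^{n-1}$ generated by coordinates up to $n-1$ is $g(a|x)$. For $j\ge1$, $\mathrm{Osc}_j(g)=\sup\{\frac12\sum_{a\in A}|g(a|z)-g(a|z')|: z,z'\in\mathcal{X}^-,\ z_k=z'_k\ \forall k\neq -j\}$, and $\Delta(g)=1-\sum_{j=1}^\infty \mathrm{Osc}_j(g)$. For $f:A^{n+1}\to\mathbb{R}$ and $0\le j\le n$, $\delta_j(f)=\sup\{|f(\omega_0^{j-1}a\,\omega_{j+1}^n)-f(\omega_0^{j-1}b\,\omega_{j+1}^n)|: a,b\in A,\ \omega\in A^{n+1}\}$. $\mathcal{L}=\bigcup_{n\ge0}\mathcal{L}_n$ with $\mathcal{L}_n=\{f:A^{n+1}\to\mathbb{R}: \delta_j(f)<\infty,\ j=0,\dots,n\}$; such $f$ is viewed as a function of the coordinates $0,\dots,n$. $\|\underline{\delta}(f)\|_2^2=\sum_{j=0}^n\delta_j(f)^2$ for $f\in\mathcal{L}_n$.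
   Formalization: The kernel is also assumed continuous: for each a, x ↦ g(a|x) is continuous in the product topology; without this the claim fails, e.g. for the equal mixture of the two constant sequences with a kernel that depends only on the remote tail. *)

(* Defs.v *)
From HB Require Import structures.
From mathcomp Require Import all_boot all_order all_algebra.
From mathcomp Require Import all_classical all_reals all_analysis.

Set Implicit Arguments.
Unset Strict Implicit.
Unset Printing Implicit Defensive.

Import Order.TTheory GRing.Theory Num.Theory.
Import numFieldNormedType.Exports.

Local Open Scope classical_set_scope.
Local Open Scope ring_scope.

Definition cylinders (A : Type) : set (set (int -> A)) :=
  [set E | exists (J : seq int) (a : int -> A),
     E = [set w | forall i, i \in J -> w i = a i]].

(* The alphabet is a [pointedType] because the library's measurable types are
   inhabited; a probability measure on A^Z forces A to be nonempty anyway. *)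
Definition biseq (A : pointedType) := g_sigma_algebraType (@cylinders A).

Definition shift (A : Type) (w : int -> A) : int -> A := fun i => w (i + 1).

Definition coord_sigma (A : Type) (S : set int) : set (set (int -> A)) :=
  <<s [set E | exists i (B : set A), S i /\ E = [set w | B (w i)]] >>.

(* X^-, with the product topology of the discrete topologies: the entry of
   index k : nat is the coordinate -(k+1). *)
Definition past (A : pointedType) := {ptws nat -> discrete_topology A}.

Definition past_before (A : pointedType) (n : int) (w : int -> A) : past A :=
  fun k : nat => w (n - k.+1%:Z).

Section kernels.
Context {R : realType} {A : pointedType}.
Implicit Types (mu : probability (biseq A) R) (g : A -> past A -> R).

Definition shift_invariant mu : Prop :=
  forall B : set (biseq A), measurable B -> mu (@shift A @^-1` B) = mu B.

Definition is_kernel g : Prop :=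
  (forall a x, 0 <= g a x <= 1) /\
  (forall x, (\esum_(a in [set: A]) (g a x)%:E = 1)%E).

(* h is a version of the conditional probability of E given the
   sub-sigma-algebra F. *)
Definition is_cond_prob mu (F : set (set (biseq A))) (E : set (biseq A))
    (h : biseq A -> R) : Prop :=
  [/\ forall B : set R, measurable B -> F (h @^-1` B),
      mu.-integrable [set: biseq A] (EFin \o h)
    & forall C, F C -> (\int[mu]_(w in C) (h w)%:E = mu (E `&` C))%E].

(* No measurability of g is required: g is only asked to agree almost
   everywhere with a version of the conditional probability. *)
Definition compatible mu g : Prop :=
  forall (n : int) (a : A), exists h : biseq A -> R,
    is_cond_prob mu (@coord_sigma A [set i | i < n]) [set w | w n = a] h /\
    {ae mu, forall w, h w = g a (past_before n w)}.

(* Meant for j >= 1: coordinate -j of a past is its entry of index j - 1. *)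
Definition Osc g (j : nat) : \bar R :=
  ereal_sup
    [set ((2^-1)%:E * \esum_(a in [set: A]) (`|g a z.1 - g a z.2|)%:E)%E
    | z in [set z : past A * past A | forall k, k.+1 != j -> z.1 k = z.2 k]].

Definition Delta g : \bar R := (1 - \sum_(1 <= j <oo) Osc g j)%E.

End kernels.

Section functions.
Context {R : realType} {A : pointedType} {n : nat}.
Implicit Types f : ('I_n.+1 -> A) -> R.

Definition delta f (j : 'I_n.+1) : \bar R :=
  ereal_sup
    [set e | exists (w : 'I_n.+1 -> A) (a b : A),
      e = (`|f [eta w with j |-> a] - f [eta w with j |-> b]|)%:E].

Definition in_L f : Prop := forall j, (delta f j < +oo)%E.

(* Meaningful on L only, where every [delta f j] is a finite number. *)
Definition delta_norm2_sq f : R := \sum_(j < n.+1) fine (delta f j) ^+ 2.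

Definition on_biseq f (w : biseq A) : R := f (fun i => w (i : nat)%:Z).

End functions.

(* Main.v *)
Require Import Defs.
From mathcomp Require Import all_boot all_order all_algebra.
From mathcomp Require Import all_classical all_reals all_analysis.
From mathcomp Require Import measurable_realfun ring lra.

(** Let [P] be the operator [P h x = sum_a g(a|x) h(x a)] on functions of the
past, and write [b_j] for the j-th oscillation of the kernel, [s < 1] for the
sum of the [b_j]. If a function [h] has single-site oscillations [c_j], then
splitting [P h x - P h y] into a change of the integrand and a change of the
measure shows that [P h] has single-site oscillations
[c'_j = c_{j+1} + c_0 b_j]. Moreover Hoeffding's lemma gives
[P (exp (t h)) <= exp (t P h + t^2 c_0^2 / 8)] pointwise, and compatibility says
that integrating [h] against the past of [k + 1] is integrating [P h] against the
past of [k]. Starting from [f] and iterating, the successive leading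
oscillations [D_k] solve the renewal equation
[D_k = f_k + sum_(i < k) D_i b_{k-1-i}], so that
[sum D_k^2 <= (1 - s)^-2 sum f_k^2] by convexity, while the total oscillation
left after [m] steps tends to [0]: in the limit only the exponential of the mean
of [t f] remains. *)

Set Implicit Arguments.
Unset Strict Implicit.
Unset Printing Implicit Defensive.

Import Order.TTheory GRing.Theory Num.Theory.
Import numFieldNormedType.Exports.

Local Open Scope classical_set_scope.
Local Open Scope ring_scope.

(** * The renewal equation *)

Section renewal.
Context {R : realType}.
Implicit Types (b c : nat -> R) (s C : R).

Definition osc_step b c : nat -> R := fun j => c j.+1 + c 0%N * b j.

(** At [j = 0] this is the renewal equation of the leading terms. Arbitrary [j] is what the
    induction needs, since one step reads entry [j.+1]. *)
Lemma iter_osc_stepE b c m j :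
  iter m (osc_step b) c j
  = c (j + m)%N + \sum_(k < m) iter k (osc_step b) c 0%N * b (j + m - k.+1)%N.
Proof.
elim: m j => [|m IH] j; first by rewrite big_ord0 addr0 addn0.
rewrite iterS /osc_step -/(osc_step b) IH big_ord_recr /= addrA addnS.
by rewrite subSS addnK; under eq_bigr do rewrite addSn.
Qed.

Lemma iter_osc_step_ge0 b c m j : (forall i, 0 <= b i) -> (forall i, 0 <= c i) ->
  0 <= iter m (osc_step b) c j.
Proof.
move=> b0 c0; elim: m j => [|m IH] j //=.
by rewrite /osc_step addr_ge0// mulr_ge0.
Qed.

(** Summation over the pairs [i < k < m] in the other order. In the induction, the new row [k = m]
    extends each inner sum by its last term. *)
Lemma sum_convolution b (x : nat -> R) m :
  \sum_(k < m) \sum_(i < k) x i * b (k - i.+1)%N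
  = \sum_(i < m) x i * \sum_(j < m - i.+1) b j.
Proof.
elim: m => [|m IH]; first by rewrite !big_ord0.
rewrite big_ord_recr /= IH big_ord_recr /= subnn big_ord0 mulr0 addr0 -big_split /=.
apply: eq_bigr => i _; rewrite -mulrDr; congr (_ * _).
by rewrite subSS -[in RHS](@subnSK i m)// big_ord_recr.
Qed.

(* Jensen with the weights [1 - s] and [w], of total mass at most 1. *)
Lemma sqr_weighted_sum_le s (c : R) k (w x : 'I_k -> R) : s < 1 ->
  (forall i, 0 <= w i) -> \sum_(i < k) w i <= s ->
  (c + \sum_(i < k) x i * w i) ^+ 2
  <= c ^+ 2 / (1 - s) + \sum_(i < k) x i ^+ 2 * w i.
Proof.
move=> s1 w0 ws; set m := _ + _.
have e : 0 < 1 - s by lra.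
(* Weighted second moment about [m] of the points [c / (1 - s)] and [x i]. The first point is chosen
   so that the weighted sum of all of them is exactly [m]. *)
have : 0 <= (1 - s) * (c / (1 - s) - m) ^+ 2 + \sum_(i < k) (x i - m) ^+ 2 * w i.
  apply: addr_ge0; first by rewrite mulr_ge0 ?sqr_ge0 ?ltW.
  by apply: sumr_ge0 => i _; rewrite mulr_ge0 ?sqr_ge0.
have -> : \sum_(i < k) (x i - m) ^+ 2 * w i
  = \sum_(i < k) x i ^+ 2 * w i - 2 * m * (\sum_(i < k) x i * w i)
    + m ^+ 2 * \sum_(i < k) w i.
  rewrite !mulr_sumr -sumrN -!big_split /=; apply: eq_bigr => i _; ring.
have -> : \sum_(i < k) x i * w i = m - c by rewrite /m addrC addKr.
have -> : (1 - s) * (c / (1 - s) - m) ^+ 2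
  = c ^+ 2 / (1 - s) - 2 * c * m + (1 - s) * m ^+ 2.
  by field; rewrite lt0r_neq0.
set S2 := \sum_(i < k) x i ^+ 2 * w i; set W := \sum_(i < k) w i => h.
have : m ^+ 2 * W <= m ^+ 2 * s by rewrite ler_wpM2l ?sqr_ge0.
by move=> h2; set q := c ^+ 2 / (1 - s) in h *; nra.
Qed.

(** Jensen applies to each instance of the renewal equation, with the reversed [b] as weights.
    Summed over [k], the convolution term is at most [s] times the left-hand sum and is absorbed
    there; this costs one factor [1 - s], Jensen the other. *)
Lemma sqr_sum_osc_step_le b c s m : (forall i, 0 <= b i) -> s < 1 ->
  (forall N, \sum_(j < N) b j <= s) ->
  (1 - s) ^+ 2 * \sum_(k < m) iter k (osc_step b) c 0%N ^+ 2
  <= \sum_(k < m) c k ^+ 2.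
Proof.
move=> b0 s1 bs; pose D k := iter k (osc_step b) c 0%N.
rewrite -/(D _); set S := \sum_(k < m) _.
have e : 0 < 1 - s by lra.
have rev_sum k : \sum_(i < k) b (k - i.+1)%N = \sum_(i < k) b i.
  by rewrite [RHS](reindex_inj rev_ord_inj).
have : S <= \sum_(k < m) (c k ^+ 2 / (1 - s) + \sum_(i < k) D i ^+ 2 * b (k - i.+1)%N).
  apply: ler_sum => k _; rewrite iter_osc_stepE add0n.
  apply: sqr_weighted_sum_le => //.
  by rewrite (_ : \sum_(i < k) _ = \sum_(i < k) b i)// -rev_sum.
rewrite big_split /= (sum_convolution _ (fun i => D i ^+ 2)) -mulr_suml => h.
have : \sum_(i < m) D i ^+ 2 * \sum_(j < m - i.+1) b j <= S * s.
  by rewrite /S mulr_suml; apply: ler_sum => i _; rewrite ler_wpM2l ?sqr_ge0.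
move=> h2; have h3 : (1 - s) * S <= (\sum_(k < m) c k ^+ 2) / (1 - s) by lra.
by rewrite expr2 -mulrA mulrC -ler_pdivlMr.
Qed.

Lemma sum_shift_cvg c C : (fun N => \sum_(j < N) c j) @ \oo --> C ->
  (fun N => \sum_(j < N) c j.+1) @ \oo --> C - c 0%N.
Proof.
move=> cC.
have -> : (fun N => \sum_(j < N) c j.+1) = (fun N => \sum_(j < N.+1) c j - c 0%N).
  by apply/funext => N; rewrite big_ord_recl addrC addKr.
by apply: cvgB; [rewrite (cvg_shiftS (fun N => \sum_(j < N) c j))|exact: cvg_cst].
Qed.

Lemma osc_step_cvg b c s C :
  (fun N => \sum_(j < N) b j) @ \oo --> s ->
  (fun N => \sum_(j < N) c j) @ \oo --> C ->
  (fun N => \sum_(j < N) osc_step b c j) @ \oo --> C - c 0%N + c 0%N * s.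
Proof.
move=> bs cC; rewrite /osc_step.
under eq_fun do rewrite big_split /= -mulr_sumr.
by apply: cvgD; [exact: sum_shift_cvg|exact: cvgMr].
Qed.

Lemma sum_ord_le_lim c C : (forall i, 0 <= c i) ->
  (fun N => \sum_(j < N) c j) @ \oo --> C -> forall N, \sum_(j < N) c j <= C.
Proof.
move=> c0 cC N; rewrite -(cvg_lim _ cC)//.
apply: (@nondecreasing_cvgn_le _ (fun N => \sum_(j < N) c j)); last first.
  by apply/cvg_ex; exists C.
apply/nondecreasing_seqP => n; by rewrite big_ord_recr /= lerDl.
Qed.

(* [C - (1 - s) * U m], the total oscillation left after [m] steps, is
   nonnegative, so [U] converges; the renewal equation forces its limit to be
   [C / (1 - s)]. *)
Lemma osc_left_cvg0 b c s C : (forall i, 0 <= b i) -> (forall i, 0 <= c i) -> s < 1 ->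
  (fun N => \sum_(j < N) b j) @ \oo --> s ->
  (fun N => \sum_(j < N) c j) @ \oo --> C ->
  (fun m => C - (1 - s) * \sum_(k < m) iter k (osc_step b) c 0%N) @ \oo --> (0 : R).
Proof.
move=> b0 c0 s1 bs cC; pose D k := iter k (osc_step b) c 0%N.
have D0 k : 0 <= D k by exact: iter_osc_step_ge0.
pose U m := \sum_(k < m) D k.
have e : 0 < 1 - s by lra.
have UE m : U m = \sum_(k < m) c k + \sum_(i < m) D i * \sum_(j < m - i.+1) b j.
  rewrite -sum_convolution -big_split /=; apply: eq_bigr => k _.
  by rewrite /D iter_osc_stepE add0n.
have Und : nondecreasing_seq U.
  by apply/nondecreasing_seqP => m; rewrite /U big_ord_recr /= lerDl.
have Ub m : (1 - s) * U m <= C.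
  have := UE m => h.
  have h1 : \sum_(i < m) D i * \sum_(j < m - i.+1) b j <= U m * s.
    rewrite /U mulr_suml; apply: ler_sum => i _.
    by rewrite ler_wpM2l// (sum_ord_le_lim b0 bs).
  have := sum_ord_le_lim c0 cC m; lra.
have Ucvg : cvgn U.
  apply: nondecreasing_is_cvgn => //; exists (C / (1 - s)) => _ [m _ <-].
  by rewrite ler_pdivlMr// mulrC.
have UL := Ucvg; set L := limn U in UL.
have UleL m : U m <= L by exact: nondecreasing_cvgn_le.
(* At time [M + M.+1] each of the first [M] inner sums still has at least [M] terms, so both factors
   of the product can be sent to their limits together. *)
have lowM M : \sum_(k < M) c k + U M * \sum_(j < M) b j <= L.
  apply: le_trans (UleL (M + M.+1)%N); rewrite [U (_ + _)%N]UE; apply: lerD.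
    by rewrite big_split_ord /= lerDl sumr_ge0.
  rewrite big_split_ord /= /U mulr_suml.
  rewrite -[leLHS]addr0; apply: lerD; last first.
    by apply: sumr_ge0 => i _; rewrite mulr_ge0 ?sumr_ge0.
  apply: ler_sum => i _; rewrite ler_wpM2l//.
  have -> : (M + M.+1 - i.+1 = M + (M - i))%N by rewrite addnS subSS addnBA// ltnW.
  by rewrite big_split_ord /= lerDl sumr_ge0.
have CL : C + L * s <= L.
  have cv : (fun M => \sum_(k < M) c k + U M * \sum_(j < M) b j) @ \oo --> C + L * s.
    by apply: cvgD => //; apply: cvgM.
  rewrite -(cvg_lim _ cv)//; apply: limr_le; first by apply/cvg_ex; exists (C + L * s).
  by apply: nearW.
have LC : (1 - s) * L <= C.
  have cv : (fun m => (1 - s) * U m) @ \oo --> (1 - s) * L by apply: cvgMr.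
  rewrite -(cvg_lim _ cv)//; apply: limr_le; first by apply/cvg_ex; exists ((1 - s) * L).
  by apply: nearW.
have : (fun m => C - (1 - s) * U m) @ \oo --> C - (1 - s) * L.
  by apply: cvgB; [exact: cvg_cst|exact: cvgMr].
by have -> : C - (1 - s) * L = 0 by lra.
Qed.

End renewal.

(** * Hoeffding's lemma *)

Section hoeffding.
Context {R : realType}.
Implicit Types (p h : R).

Let den p h := (1 - p) + p * expR h.

Let den_gt0 p h : 0 <= p <= 1 -> 0 < den p h.
Proof.
move=> /andP[p0 p1]; rewrite /den; have := expR_gt0 h => e0.
have [->|pn] := eqVneq p 0; first by rewrite mul0r; lra.
have : 0 < p * expR h by rewrite mulr_gt0// lt0r pn.
lra.
Qed.

Lemma ger0_is_derive_le (f df : R -> R) (a : R) :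
  (forall x : R, is_derive x 1 f (df x)) -> (forall x, a <= x -> 0 <= df x) ->
  forall x, a <= x -> f a <= f x.
Proof.
move=> fdf df0 x ax; apply: (@ger0_derive1_ndecry _ f a) => //.
- by move=> y; rewrite in_itv/= andbT => ay; rewrite derive1E derive_val df0 ?ltW.
- apply: continuous_subspaceT => y; apply: differentiable_continuous.
  exact/derivable1_diffP.
Qed.

(** Both sides equal [p] at 0, and the logistic function on the left has slope
    [q * (1 - q) <= 1 / 4], where [q] is its value. *)
Lemma logistic_le p h : 0 <= p <= 1 -> 0 <= h ->
  p * expR h / den p h <= p + h / 4.
Proof.
move=> p01 h0.
(* The logistic function is rewritten as [1 - (1 - p) / den p x], so that only an inverse has to be
   differentiated. *)
pose f (x : R) := p + x / 4 - 1 + (1 - p) * (den p x)^-1.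
have D (x : R) : is_derive x 1 (den p) (p * expR x).
  by rewrite /den; apply: is_derive_eq; rewrite add0r /GRing.scale /=; ring.
pose df (x : R) := 1 / 4 - (1 - p) * (p * expR x) * (den p x)^-2.
have fdf (x : R) : is_derive x 1 f (df x).
  have dn : den p x != 0 by rewrite gt_eqF ?den_gt0.
  have DV := is_deriveV dn (D x).
  by rewrite /f; apply: is_derive_eq; rewrite /df /GRing.scale /=; ring.
have : f 0 <= f h.
  apply: (ger0_is_derive_le fdf) h0 => x _; have d0 := den_gt0 x p01.
  rewrite subr_ge0 ler_pdivrMr ?exprn_gt0//.
  have : 0 <= (1 - p - p * expR x) ^+ 2 by exact: sqr_ge0.
  by rewrite /den; lra.
rewrite /f /den expR0 mulr1 subrK invr1.
have d0 := den_gt0 h p01; rewrite -/(den p h) => H.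
have -> : p * expR h / den p h = 1 - (1 - p) * (den p h)^-1.
  by rewrite /den; field; rewrite gt_eqF.
lra.
Qed.

(** The difference of the logarithms vanishes at 0, and its derivative is nonnegative by
    [logistic_le]. *)
Lemma bernoulli_mgf_le_nneg p h : 0 <= p <= 1 -> 0 <= h ->
  1 - p + p * expR h <= expR (p * h + h ^+ 2 / 8).
Proof.
move=> p01 h0.
pose f (x : R) := p * x + x ^+ 2 / 8 - ln (den p x).
have D (x : R) : is_derive x 1 (den p) (p * expR x).
  by rewrite /den; apply: is_derive_eq; rewrite add0r /GRing.scale /=; ring.
have fdf (x : R) : is_derive x 1 f (p + x / 4 - p * expR x / den p x).
  have L := is_derive1_ln (den_gt0 x p01).
  have LD := is_derive1_comp L (D x).
  rewrite /f; apply: is_derive_eq; rewrite /GRing.scale /=.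
  by field; rewrite gt_eqF ?den_gt0.
have : f 0 <= f h.
  by apply: (ger0_is_derive_le fdf) h0 => x x0; rewrite subr_ge0 logistic_le.
rewrite /f /den expR0 !mulr1 mulr0 expr0n/= mul0r subrK ln1 !addr0 oppr0 addr0.
rewrite subr_ge0 -ler_expR lnK// posrE; exact: den_gt0.
Qed.

(** A negative [h] is reflected: factoring out [expR h] exchanges [p] with [1 - p] and [h] with
    [- h]. *)
Lemma bernoulli_mgf_le p h : 0 <= p <= 1 ->
  1 - p + p * expR h <= expR (p * h + h ^+ 2 / 8).
Proof.
move=> p01; have [|h0] := leP 0 h; first exact: bernoulli_mgf_le_nneg.
have q01 : 0 <= 1 - p <= 1 by lra.
have hN : 0 <= - h by lra.
have := bernoulli_mgf_le_nneg q01 hN.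
rewrite -(ler_pM2l (expR_gt0 h)) -expRD.
have -> : expR h * (1 - (1 - p) + (1 - p) * expR (- h))
  = p * expR h + (1 - p) * (expR h * expR (- h)) by ring.
rewrite expRxMexpNx_1.
have -> : h + ((1 - p) * - h + (- h) ^+ 2 / 8) = p * h + h ^+ 2 / 8 by field.
by rewrite mulr1 addrC.
Qed.

Lemma expR_le_chord (l d t u : R) : 0 < d -> l <= u <= l + d ->
  expR (t * u) <= expR (t * l) + (u - l) / d * (expR (t * (l + d)) - expR (t * l)).
Proof.
move=> d0 /andP[lu ud].
pose q := (u - l) / d.
have q0 : 0 <= q by rewrite divr_ge0 ?subr_ge0// ltW.
have q1 : q <= 1 by rewrite ler_pdivrMr// mul1r lerBlDl.
have := convex_expR (Itv01 q0 q1) (t * (l + d)) (t * l).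
rewrite !convRE /= /unstable.onem.
have -> : q * (t * (l + d)) + (1 - q) * (t * l) = t * u.
  by rewrite /q; field; rewrite gt_eqF.
by rewrite -/q; lra.
Qed.

End hoeffding.

(** * Expectations under probability mass functions on the natural numbers *)

Section pmf.
Context {R : realType}.
Implicit Types (p q phi : nat -> R) (d t M : R).

Definition pmf p :=
  (forall m, 0 <= p m) /\ (\int[counting]_m (p m)%:E = 1)%E.

Definition pexp p phi : R := \int[counting]_m (p m * phi m).

Lemma pmf_integrable p : pmf p -> (@counting nat R).-integrable [set: nat] (EFin \o p).
Proof.
move=> [p0 p1]; apply/integrableP; split => //.
under eq_integral do rewrite /= ger0_norm//.
by rewrite p1 ltry.
Qed.

Lemma integrable_mul_bounded p phi M : (@counting nat R).-integrable [set: nat] (EFin \o p) ->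
  (forall m, `|phi m| <= M) ->
  (@counting nat R).-integrable [set: nat] (EFin \o (fun m => p m * phi m)).
Proof.
move=> ip bphi.
rewrite (_ : _ \o _ = (EFin \o p) \* (EFin \o phi))%E; last first.
  by apply/funext => m /=; rewrite EFinM.
apply: integrableMl => //.
exists M; split; first exact: num_real.
by move=> x Mx m _ /=; rewrite (le_trans (bphi m)) ?ltW.
Qed.

Lemma pexp_affine p phi M a b : pmf p -> (forall m, `|phi m| <= M) ->
  pexp p (fun m => a + b * phi m) = a + b * pexp p phi.
Proof.
move=> pp bphi; have ip := pmf_integrable pp.
have iphi := integrable_mul_bounded ip bphi.
rewrite /pexp.
under eq_Rintegral do rewrite mulrDr mulrC [_ * (b * _)]mulrCA.
rewrite RintegralD//; first last.
- have := integrableZl measurableT b iphi.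
  by apply: eq_integrable => // x _; rewrite /= EFinM.
- have := integrableZl measurableT a ip.
  by apply: eq_integrable => // x _; rewrite /= EFinM.
rewrite !RintegralZl//; congr (_ + _).
by rewrite /Rintegral; case: pp => _ ->; rewrite mulr1.
Qed.

Lemma pexp_le p phi psi M : pmf p ->
  (forall m, `|phi m| <= M) -> (forall m, `|psi m| <= M) ->
  (forall m, phi m <= psi m) -> pexp p phi <= pexp p psi.
Proof.
move=> pp b1 b2 le; have ip := pmf_integrable pp.
apply: le_Rintegral => //; try exact: integrable_mul_bounded.
by move=> m _; rewrite ler_wpM2l//; case: pp.
Qed.

Lemma osc_range phi d : (forall m m', `|phi m - phi m'| <= d) ->
  exists l, forall m, l <= phi m <= l + d.
Proof.
move=> osc; exists (inf (range phi)) => m.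
have rn : range phi !=set0 by exists (phi 0%N), 0%N.
have lb m' : lbound (range phi) (phi m' - d).
  move=> _ [k _ <-]; have := osc m' k; rewrite ler_norml; lra.
apply/andP; split.
  apply: ge_inf; last by exists m.
  by exists (phi 0%N - d).
have := lb_le_inf rn (lb m); lra.
Qed.

(** Hoeffding's lemma. On the range [[l, l + d]] the exponential lies below its chord, and the
    expectation of the chord depends on the mean [u] only: it is that of a two-point law with weight
    [(u - l) / d] on [l + d]. *)
Lemma pexp_expR_le p phi d t : pmf p ->
  (forall m m', `|phi m - phi m'| <= d) ->
  pexp p (fun m => expR (t * phi m)) <= expR (t * pexp p phi + t ^+ 2 * d ^+ 2 / 8).
Proof.
move=> pp osc; have [l hl] := osc_range osc.
have d0 : 0 <= d by rewrite (le_trans _ (osc 0%N 0%N)).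
have bphi m : `|phi m| <= `|l| + d.
  have := hl m; have := ler_norm l; have := ler_norm (- l); rewrite normrN ler_norml.
  lra.
have const_pexp (c : R) : pexp p (fun=> c) = c.
  have := @pexp_affine p phi _ c 0 pp bphi; rewrite mul0r addr0 => {2}<-.
  by congr (pexp p _); apply/funext => m; rewrite mul0r addr0.
(* The chord divides by [d], so a constant [phi] is treated apart. *)
have [d_eq0|dN0] := eqVneq d 0.
  have -> : phi = fun=> l.
    by apply/funext => m; apply/eqP; rewrite eq_le andbC; have := hl m; rewrite d_eq0 addr0.
  by rewrite !const_pexp d_eq0 expr0n/= mulr0 mul0r addr0.
have dp : 0 < d by rewrite lt0r dN0.
pose u := pexp p phi.
have ul : l <= u <= l + d.
  apply/andP; split.
    rewrite -[leLHS](const_pexp l); apply: (@pexp_le _ _ _ (`|l| + d)) => //.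
    - by move=> m; rewrite lerDl.
    - by move=> m; have /andP[] := hl m.
  rewrite -[leRHS](const_pexp (l + d)); apply: (@pexp_le _ _ _ (`|l| + d)) => //.
  - by move=> m; rewrite (le_trans (ler_normD _ _))// lerD2l ger0_norm.
  - by move=> m; have /andP[] := hl m.
pose E0 := expR (t * l); pose E1 := expR (t * (l + d)).
pose b := (E1 - E0) / d.
have chordE (x : R) : E0 + (x - l) / d * (E1 - E0) = (E0 - l * b) + b * x.
  by rewrite /b; field.
apply: (@le_trans _ _ (E0 + (u - l) / d * (E1 - E0))).
  rewrite chordE -(pexp_affine _ _ pp bphi).
  pose M := `|t| * (`|l| + d).
  pose M' := `|E0 - l * b| + `|b| * (`|l| + d).
  apply: (@pexp_le _ _ _ (Num.max (expR M) M')) => // m.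
  - rewrite le_max ger0_norm ?expR_ge0// ler_expR.
    apply/orP; left; rewrite (le_trans (ler_norm _))// normrM.
    by rewrite ler_wpM2l.
  - rewrite le_max; apply/orP; right.
    by rewrite (le_trans (ler_normD _ _))// normrM lerD2l ler_wpM2l.
  - by rewrite -chordE expR_le_chord.
have q01 : 0 <= (u - l) / d <= 1.
  have /andP[lu ud] := ul.
  by rewrite divr_ge0 ?subr_ge0//= ler_pdivrMr// mul1r lerBlDl.
have := bernoulli_mgf_le (t * d) q01.
rewrite -(ler_pM2l (expR_gt0 (t * l))) -expRD -/u.
have -> : t * l + ((u - l) / d * (t * d) + (t * d) ^+ 2 / 8) = t * u + t ^+ 2 * d ^+ 2 / 8.
  by field.
have E1E : E1 = E0 * expR (t * d) by rewrite /E1 mulrDr expRD.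
by apply: le_trans; rewrite E1E -/E0 le_eqVlt; apply/orP; left; apply/eqP; ring.
Qed.

(* Centering [phi] at the middle of its range gains the factor 1/2 of the total
   variation distance. *)
Lemma pexp_dist_le p q phi d e : pmf p -> pmf q ->
  (forall m m', `|phi m - phi m'| <= d) ->
  ((2^-1)%:E * \int[counting]_m `|p m - q m|%:E <= e%:E)%E ->
  `|pexp p phi - pexp q phi| <= d * e.
Proof.
move=> pp pq osc tv; have [l hl] := osc_range osc.
have d0 : 0 <= d by rewrite (le_trans _ (osc 0%N 0%N)).
pose c := l + d / 2; pose psi m := - c + 1 * phi m.
have bpsi m : `|psi m| <= d / 2.
  by rewrite /psi /c ler_norml; have := hl m; lra.
have bphi m : `|phi m| <= `|l| + d.
  have := hl m; have := ler_norm l; have := ler_norm (- l); rewrite normrN ler_norml.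
  lra.
have ip := pmf_integrable pp; have iq := pmf_integrable pq.
have ipq : (@counting nat R).-integrable [set: nat] (EFin \o (fun m => p m - q m)).
  have := integrableB measurableT ip iq.
  by apply: eq_integrable => // m _; rewrite /= EFinB.
have -> : pexp p phi - pexp q phi = \int[counting]_m ((p m - q m) * psi m).
  under eq_Rintegral do rewrite mulrBl.
  rewrite RintegralB//; try exact: (integrable_mul_bounded (M := d / 2)).
  rewrite -/(pexp p psi) -/(pexp q psi) !(pexp_affine _ _ _ bphi)//; lra.
apply: le_trans (le_normr_Rintegral _ _) _ => //.
  exact: (integrable_mul_bounded (M := d / 2)).
have i1 := integrable_norm ipq.
apply: (@le_trans _ _ (\int[counting]_m (d / 2 * `|p m - q m|))).
  apply: le_Rintegral => //.
  - apply: integrable_norm; exact: (integrable_mul_bounded (M := d / 2)).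
  - have := integrableZl measurableT (d / 2) i1.
    by apply: eq_integrable => // m _; rewrite /= EFinM.
  - by move=> m _; rewrite normrM mulrC ler_wpM2r.
rewrite RintegralZl// -mulrA ler_wpM2l//.
rewrite -lee_fin; apply: le_trans tv; rewrite EFinM /Rintegral fineK//.
exact: integrable_fin_num i1.
Qed.

End pmf.

(** * The kernel operator and oscillations *)

Section past_functions.
Context {R : realType} {A : pointedType}.
Implicit Types (x y : past A) (h : past A -> R) (c : nat -> R) (C : R).

Definition past_cons (a : A) x : past A := fun k => if k is k'.+1 then x k' else a.

(* With [C] the sum of [c], this says that [|h x - h y|] is at most the sum of
   the [c j] over the [j] such that [x j <> y j]. *)
Definition osc_dominated c C h :=
  forall N x y, `|h x - h y| <= C - \sum_(j < N | (x j : A) == y j) c j.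

Lemma osc_dominated_dist c C h x y : osc_dominated c C h -> `|h x - h y| <= C.
Proof. by move=> /(_ 0%N x y); rewrite big_ord0 subr0. Qed.

Lemma osc_dominated_bounded c C h : osc_dominated c C h ->
  exists M, 0 <= M /\ forall x, `|h x| <= M.
Proof.
move=> hc; exists (`|h (fun=> point)| + C); split.
  by rewrite addr_ge0// (le_trans _ (osc_dominated_dist (fun=> point) (fun=> point) hc)).
move=> x; have := osc_dominated_dist x (fun=> point) hc.
have := ler_normD (h (fun=> point)) (h x - h (fun=> point)).
by rewrite subrKC; lra.
Qed.

Lemma osc_dominated_lipschitz c C h (f : R -> R) L : 0 <= L ->
  (forall x y, `|f (h x) - f (h y)| <= L * `|h x - h y|) ->
  osc_dominated c C h -> osc_dominated (fun j => L * c j) (L * C) (f \o h).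
Proof.
move=> L0 lip hc N x y; apply: le_trans (lip x y) _.
by rewrite -mulr_sumr -mulrBr ler_wpM2l.
Qed.

Lemma expR_lipschitz (M u v : R) : `|u| <= M -> `|v| <= M ->
  `|expR u - expR v| <= expR M * `|u - v|.
Proof.
have half (a b : R) : `|a| <= M -> expR a - expR b <= expR M * `|a - b|.
  move=> aM; have h1 : expR a - expR b <= expR a * (a - b).
    have := expR_ge1Dx (b - a); rewrite -(ler_pM2l (expR_gt0 a)) -expRD subrKC.
    by rewrite mulrDr mulr1; lra.
  apply: (le_trans h1); apply: (@le_trans _ _ (expR a * `|a - b|)).
    by rewrite ler_wpM2l ?expR_ge0// ler_norm.
  by rewrite ler_wpM2r// ler_expR (le_trans (ler_norm _)).
move=> uM vM; rewrite ler_norml; apply/andP; split; last exact: half.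
by rewrite lerNl opprB distrC half.
Qed.

(** The constants are crude; the point is that the exponential is again dominated by a summable
    sequence, hence measurable and open to the use of compatibility. *)
Lemma osc_dominated_expR c C h t M : (forall x, `|h x| <= M) ->
  osc_dominated c C h ->
  osc_dominated (fun j => expR (`|t| * M) * `|t| * c j)
    (expR (`|t| * M) * `|t| * C) (fun x => expR (t * h x)).
Proof.
move=> hM hc; apply: (@osc_dominated_lipschitz _ _ h (fun u => expR (t * u))) => //.
move=> x y; rewrite -mulrA -normrM mulrBr; apply: expR_lipschitz.
- by rewrite normrM ler_wpM2l.
- by rewrite normrM ler_wpM2l.
Qed.

Lemma osc_dominated_addl c C h r : osc_dominated c C h ->
  osc_dominated c C (fun x => r + h x).
Proof. by move=> hc N x y; rewrite opprD addrACA subrr add0r. Qed.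

Lemma osc_dominated_cons c C h a : osc_dominated c C h ->
  osc_dominated (fun j => c j.+1) (C - c 0%N) (h \o past_cons a).
Proof.
move=> hc N x y; have := hc N.+1 (past_cons a x) (past_cons a y).
rewrite big_mkcond big_ord_recl /= eqxx opprD addrA.
by move=> H; rewrite big_mkcond.
Qed.

Lemma sum_le_lim c C K : (fun N => \sum_(j < N) c j) @ \oo --> C ->
  (forall N, \sum_(j < N) c j <= K) -> C <= K.
Proof.
move=> cC cK; rewrite -(cvg_lim _ cC)//; apply: limr_le.
  by apply/cvg_ex; exists C.
exact: nearW.
Qed.

(** The two pasts agree from entry 1 on, so domination leaves only [c 0] in the limit. The proof
    phrases this as a bound on all partial sums of [c], hence on [C]. *)
Lemma osc_dominated_head c C h a b x : (forall j, 0 <= c j) ->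
  (fun N => \sum_(j < N) c j) @ \oo --> C -> osc_dominated c C h ->
  `|h (past_cons a x) - h (past_cons b x)| <= c 0%N.
Proof.
move=> c0 cC hc; set e := `|_|.
suff : C <= C + c 0%N - e by lra.
apply: (sum_le_lim cC) => N.
have := hc N.+1 (past_cons a x) (past_cons b x); rewrite -/e.
rewrite big_mkcond big_ord_recl /=.
rewrite (eq_bigr (fun i : 'I_N => c (bump 0 i))); last by move=> i _; rewrite eqxx.
have : \sum_(j < N) c j <= \sum_(j < N.+1) c j by rewrite big_ord_recr lerDl.
rewrite big_ord_recl /=; case: ifP => _; have := c0 0%N; lra.
Qed.

End past_functions.

(* The countable alphabet is coded in [nat], where sums are integrals against
   the counting measure; integers that code no letter get weight 0. *)
Section coding.
Context {R : realType} {A : pointedType} (code : A -> nat) (code_inj : injective code).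
Implicit Types (u : A -> \bar R).

(** An integer that codes no letter is sent to [point]; the test [code (decode m) == m] tells the
    true codes apart. *)
Definition decode (m : nat) : A := xget point [set a | code a = m].

Lemma codeK : cancel code decode.
Proof. by move=> a; rewrite /decode; case: xgetP => [b _ /code_inj//|/(_ a)[]]. Qed.

Lemma esum_code u : (forall a, 0 <= u a)%E ->
  (\esum_(a in [set: A]) u a =
   \int[counting]_m (if code (decode m) == m then u (decode m) else 0))%E.
Proof.
move=> u0; rewrite ge0_integral_count; last by move=> m; case: ifP.
rewrite nneseries_esumT; last by move=> m; case: ifP.
have -> : (\esum_(a in [set: A]) u a = \esum_(a in [set: A]) (u \o decode) (code a))%E.
  by apply: eq_esum => a _ /=; rewrite codeK.
rewrite -(@esum_image _ _ _ _ code (u \o decode)); last by move=> a b _ _ /code_inj.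
rewrite esum_mkcond; apply: eq_esum => m _.
suff -> : (m \in [set code x | x in [set: A]]) = (code (decode m) == m) by [].
apply/idP/eqP => [|<-]; first by rewrite inE => -[a _ <-]; rewrite codeK.
by rewrite inE; exists (decode m).
Qed.

End coding.

(** * Total variation between the laws of the next letter, and the action of the operator on
    oscillations *)

Section kernel_operator.
Context {R : realType} {A : pointedType} (code : A -> nat) (code_inj : injective code).
Variable g : A -> past A -> R.
Hypotheses (g_kernel : is_kernel g) (g_continuous : forall a : A, continuous (g a)).
Variables (b : nat -> R) (s : R).
Hypotheses (b_ge0 : forall j, 0 <= b j)
  (b_cvg : (fun N => \sum_(j < N) b j) @ \oo --> s)
  (Osc_b : forall j, (Osc g j.+1 <= (b j)%:E)%E).
Implicit Types (x y : past A) (h : past A -> R) (c : nat -> R) (C : R).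
Local Notation decode := (decode code).

Definition kernel_pmf x (m : nat) : R :=
  if code (decode m) == m then g (decode m) x else 0.

Lemma kernel_pmfP x : pmf (kernel_pmf x).
Proof.
have [g01 g1] := g_kernel; split=> [m|].
  by rewrite /kernel_pmf; case: ifP => // _; have /andP[] := g01 (decode m) x.
rewrite -[RHS](g1 x) (esum_code code_inj); last first.
  by move=> a; rewrite lee_fin; have /andP[] := g01 a x.
by apply: eq_integral => m _; rewrite /kernel_pmf; case: ifP.
Qed.

Definition splice N x y : past A := fun k => if (k < N)%N then y k else x k.

Lemma splice_cvg x y : (fun N => splice N x y) @ \oo --> y.
Proof.
apply/pointwise_cvgP => k; apply: cvg_near_cst.
by exists k.+1 => // N /= kN; rewrite /splice kN.
Qed.

(** Going from [x] to [y] one entry at a time, a change of entry [j] costs at most [Osc g j.+1], and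
    an entry where they agree costs nothing. Finitely many letters are kept so that a limit in [N]
    can be taken termwise. *)
Lemma sum_half_dist_splice_le (F : seq A) N x y : uniq F ->
  2^-1 * \sum_(a <- F) `|g a x - g a (splice N x y)|
  <= \sum_(j < N | (x j : A) != y j) b j.
Proof.
move=> uF; elim: N => [|N IH].
  rewrite big_ord0 big1 ?mulr0// => a _; apply/eqP; rewrite normr_eq0 subr_eq0; apply/eqP.
  by congr g; apply/funext => k.
rewrite [leRHS]big_mkcond big_ord_recr /= -[X in _ <= X + _]big_mkcond.
apply: (@le_trans _ _ (2^-1 * \sum_(a <- F) `|g a x - g a (splice N x y)| +
   2^-1 * \sum_(a <- F) `|g a (splice N x y) - g a (splice N.+1 x y)|)).
  rewrite -mulrDr -big_split ler_wpM2l ?invr_ge0//=.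
  by apply: ler_sum => a _; exact: ler_distD.
apply: lerD => //; have [e|ne] := eqVneq (x N : A) (y N : A).
  have -> : splice N.+1 x y = splice N x y.
    apply/funext => k; rewrite /splice ltnS leq_eqVlt.
    by have [->/=|//] := eqVneq k N; rewrite ltnn.
  by rewrite big1 ?mulr0// => a _; rewrite subrr normr0.
rewrite -lee_fin; apply: le_trans (Osc_b N).
apply: le_trans (ereal_sup_ubound _); last first.
  exists (splice N x y, splice N.+1 x y) => //= k kN.
  by rewrite /splice ltnS [(k <= N)%N]leq_eqVlt; move: kN; rewrite eqSS => /negbTE->.
rewrite EFinM lee_wpmul2l// -sumEFin; apply: esum_ge; exists [set` F] => //.
  by split => //; exact: finite_seq.
by rewrite fsbig_seq.
Qed.

(** Continuity of [g] carries the bound for finitely many changed entries over to all of [y], for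
    each finite set of letters; the supremum over these sets comes last. *)
Lemma tv_kernel_pmf_le N x y :
  ((2^-1)%:E * \int[counting]_m `|kernel_pmf x m - kernel_pmf y m|%:E
   <= (s - \sum_(j < N | (x j : A) == y j) b j)%:E)%E.
Proof.
set K := s - _.
have -> : (\int[counting]_m `|kernel_pmf x m - kernel_pmf y m|%:E
           = \esum_(a in [set: A]) `|g a x - g a y|%:E)%E.
  rewrite (esum_code code_inj)//; apply: eq_integral => m _.
  by rewrite /kernel_pmf; case: ifP => //; rewrite subrr normr0.
suff H : (\esum_(a in [set: A]) `|g a x - g a y|%:E <= (2 * K)%:E)%E.
  have -> : K = 2^-1 * (2 * K) by field.
  by rewrite EFinM lee_wpmul2l.
apply: ge_ereal_sup => _ [X [finX _] <-].
rewrite fsbig_finite// sumEFin lee_fin.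
have uX := finmap.fset_uniq (fset_set X); set F := finmap.enum_fset _ in uX *.
rewrite -ler_pdivrMl//.
have cv : (fun M => 2^-1 * \sum_(a <- F) `|g a x - g a (splice M x y)|) @ \oo
    --> 2^-1 * \sum_(a <- F) `|g a x - g a y|.
  apply: cvgMr; apply: cvg_big => [|a _]; first exact: add_continuous.
  apply: cvg_norm.
  apply: cvgB; first exact: cvg_cst.
  exact: (cvg_comp _ _ (@splice_cvg x y) (@g_continuous a y)).
rewrite -(cvg_lim _ cv)//; apply: limr_le; first by apply/cvg_ex; eexists; exact: cv.
apply: nearW => M; apply: le_trans (sum_half_dist_splice_le M x y uX) _.
(* Disagreements below [M] and agreements below [N] are disjoint sets of indices below [maxn M N],
   and a partial sum of [b] is at most [s]. *)
rewrite /K lerBrDr.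
have bs := sum_ord_le_lim b_ge0 b_cvg (maxn M N).
apply: le_trans bs; rewrite [leRHS](bigID (fun j : 'I__ => (x j : A) == y j)) /= addrC.
have mono (P : pred nat) m n : (m <= n)%N ->
    \sum_(j < m | P j) b j <= \sum_(j < n | P j) b j.
  move=> mn; rewrite (big_ord_widen_cond _ P b mn).
  rewrite big_mkcond [leRHS]big_mkcond; apply: ler_sum => j _.
  by case: (P j); case: (_ < _)%N => /=.
apply: lerD.
- by apply: (mono (fun j => (x j : A) != y j)); exact: leq_maxl.
- by apply: (mono (fun j => (x j : A) == y j)); exact: leq_maxr.
Qed.

Definition kernel_op h x : R :=
  pexp (kernel_pmf x) (fun m => h (past_cons (decode m) x)).

Lemma kernel_op_affine h M r t x : (forall x, `|h x| <= M) ->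
  kernel_op (fun x => r + t * h x) x = r + t * kernel_op h x.
Proof. by move=> hM; exact: (pexp_affine _ _ (kernel_pmfP x) (M := M)). Qed.

Lemma kernel_op_bounded h M x : (forall x, `|h x| <= M) -> `|kernel_op h x| <= M.
Proof.
move=> hM; have M0 : 0 <= M by rewrite (le_trans _ (hM x)).
have cE (r : R) : r = kernel_op (fun x => r + 0 * h x) x.
  by rewrite (kernel_op_affine _ _ _ hM) mul0r addr0.
rewrite ler_norml; apply/andP; split.
  rewrite [leLHS]cE; apply: (pexp_le (kernel_pmfP x) (M := M)) => // m.
  - by rewrite mul0r addr0 normrN ger0_norm.
  - by rewrite mul0r addr0; have := hM (past_cons (decode m) x); rewrite ler_norml => /andP[].
rewrite [leRHS]cE; apply: (pexp_le (kernel_pmfP x) (M := M)) => // m.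
- by rewrite mul0r addr0 ger0_norm.
- by rewrite mul0r addr0; have := hM (past_cons (decode m) x); rewrite ler_norml => /andP[].
Qed.

Lemma kernel_op_dominated c C h : (forall j, 0 <= c j) ->
  (fun N => \sum_(j < N) c j) @ \oo --> C -> osc_dominated c C h ->
  osc_dominated (osc_step b c) (C - c 0%N + c 0%N * s) (kernel_op h).
Proof.
move=> c0 cC hc N x y; have [M [M0 hM]] := osc_dominated_bounded hc.
(* Intermediate quantity: the letter is still drawn from the law given [x], but appended to [y].
   Then [d1] changes the integrand and [d2] the law. *)
pose psi m := h (past_cons (decode m) y).
have d1 : `|kernel_op h x - pexp (kernel_pmf x) psi|
    <= C - c 0%N - \sum_(j < N | (x j : A) == y j) c j.+1.
  set K := leRHS.
  have hK m : `|h (past_cons (decode m) x) - psi m| <= K.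
    exact: (osc_dominated_cons (decode m) hc N x y).
  pose B := M + K.
  have BM z : `|h z| <= B.
    by rewrite (le_trans (hM z))// lerDl (le_trans _ (hK 0%N)).
  have le1 (phi1 phi2 : nat -> R) : (forall m, `|phi1 m| <= M) -> (forall m, `|phi2 m| <= M) ->
      (forall m, `|phi1 m - phi2 m| <= K) ->
      pexp (kernel_pmf x) phi1 - pexp (kernel_pmf x) phi2 <= K.
    move=> p1M p2M p12; rewrite lerBlDr.
    have -> : K + pexp (kernel_pmf x) phi2 = pexp (kernel_pmf x) (fun m => K + 1 * phi2 m).
      by rewrite (pexp_affine _ _ (kernel_pmfP x) p2M) mul1r.
    have K0 : 0 <= K by rewrite (le_trans _ (p12 0%N)).
    apply: (pexp_le (kernel_pmfP x) (M := B)) => m.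
    - by rewrite (le_trans (p1M m))// lerDl.
    - by rewrite mul1r (le_trans (ler_normD _ _))// /B addrC lerD// ger0_norm.
    - by have := p12 m; rewrite ler_norml; lra.
  rewrite ler_norml lerNl opprB; apply/andP; split; apply: le1 => m //; try exact: hM.
  by rewrite distrC.
have d2 : `|pexp (kernel_pmf x) psi - kernel_op h y|
    <= c 0%N * (s - \sum_(j < N | (x j : A) == y j) b j).
  apply: pexp_dist_le; [exact: kernel_pmfP|exact: kernel_pmfP| |exact: tv_kernel_pmf_le].
  by move=> m m'; exact: (osc_dominated_head _ _ _ c0 cC hc).
apply: le_trans (ler_distD (pexp (kernel_pmf x) psi) _ _) _.
apply: le_trans (lerD d1 d2) _.
rewrite /osc_step big_split /= -mulr_sumr; lra.
Qed.

Lemma kernel_op_expR_le c C h t x : (forall j, 0 <= c j) ->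
  (fun N => \sum_(j < N) c j) @ \oo --> C -> osc_dominated c C h ->
  kernel_op (fun x => expR (t * h x)) x
  <= expR (t * kernel_op h x + t ^+ 2 * c 0%N ^+ 2 / 8).
Proof.
move=> c0 cC hc; apply: (pexp_expR_le (phi := fun m => h (past_cons (decode m) x))).
  exact: kernel_pmfP.
by move=> m m'; exact: (osc_dominated_head _ _ _ c0 cC hc).
Qed.

End kernel_operator.

(** * Compatibility *)

Section past_sigma_algebra.
Context {R : realType} {A : pointedType} (code : A -> nat) (code_inj : injective code).
Implicit Types (x y : past A) (h : past A -> R) (c : nat -> R) (C : R).
Local Notation decode := (decode code).
Local Notation past_sigma n := (@coord_sigma A [set i : int | i < n]).

(** The first [N] entries packed into one integer: a countably valued function of the past, whose
    fibers lie in the past sigma-algebra. *)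
Definition prefix_code N x : nat := pickle [seq code (x i) | i <- iota 0 N].

Definition prefix_decode (m : nat) : past A :=
  fun k => decode (nth 0%N (odflt [::] (unpickle m)) k).

Lemma prefix_codeK N x k : (k < N)%N -> prefix_decode (prefix_code N x) k = x k.
Proof.
move=> kN; rewrite /prefix_decode /prefix_code pickleK /= (nth_map 0%N) ?size_iota//.
by rewrite nth_iota// add0n codeK.
Qed.

(** The decoded past agrees with [x] on its first [N] entries, so the error is at most the tail of
    the series of [c], whatever fills the other entries. *)
Lemma prefix_cvg c C h x : (fun N => \sum_(j < N) c j) @ \oo --> C ->
  osc_dominated c C h ->
  (fun N => h (prefix_decode (prefix_code N x))) @ \oo --> h x.
Proof.
move=> cC hc.
apply/cvgrPdist_le => e e0; have [] := (@cvgrPdist_le _ _ _ _ _ _ _).1 cC e e0.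
move=> N0 _ HN; exists N0 => // N /= /HN; apply: le_trans.
apply: le_trans (hc N _ _) _; rewrite (eq_bigl predT) ?ler_norm// => j.
by rewrite prefix_codeK ?eqxx.
Qed.

Lemma past_sigma_coord n i (B : set A) : i < n ->
  past_sigma n [set w | B (w i)].
Proof. by move=> ni; apply: sub_sigma_algebra; exists i, B. Qed.

Lemma past_sigma0 n : past_sigma n set0.
Proof. by rewrite /coord_sigma; exact: sigma_algebra0. Qed.

Lemma past_sigmaT n : past_sigma n setT.
Proof. by rewrite -setC0; apply: sigma_algebraC; exact: past_sigma0. Qed.

Lemma past_sigmaI n (E F : set (int -> A)) :
  past_sigma n E -> past_sigma n F -> past_sigma n (E `&` F).
Proof.
set G := [set E | exists i (B : set A), [set i : int | i < n] i /\ E = [set w | B (w i)]].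
move=> mE mF; exact: (@measurableI _ (g_sigma_algebraType G)).
Qed.

Lemma past_sigma_prefix_code n N m :
  past_sigma n [set w | prefix_code N (past_before n w) = m].
Proof.
have [[s <-]|nos] := pselect (exists s : seq nat, pickle s = m); last first.
  rewrite (_ : [set w : int -> A | _] = set0); first exact: past_sigma0.
  by apply/seteqP; split=> // w /= e; apply: nos; eexists; exact: e.
have -> : [set w | prefix_code N (past_before n w) = pickle s]
  = [set w | [seq code (past_before n w i) | i <- iota 0 N] = s].
  by apply/seteqP; split=> w /=; [move/(pcan_inj pickleK)|rewrite /prefix_code => ->].
(* The first index of the enumeration is generalized from 0 to [k], since peeling off one entry
   moves it. *)
elim: N 0%N s => [|N IH] k [|v s] /=.
- rewrite (_ : [set w : int -> A | _] = setT); last by apply/seteqP.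
  exact: past_sigmaT.
- rewrite (_ : [set w : int -> A | _] = set0); first exact: past_sigma0.
  by apply/seteqP; split.
- rewrite (_ : [set w : int -> A | _] = set0); first exact: past_sigma0.
  by apply/seteqP; split.
rewrite (_ : [set w : int -> A | _] = [set w | [set a | code a = v] (w (n - k.+1%:Z))] `&`
    [set w | [seq code (past_before n w i) | i <- iota k.+1 N] = s]); last first.
  by apply/seteqP; split=> w /= [] => [<- <-|-> ->].
apply: past_sigmaI => //; apply: past_sigma_coord.
by rewrite ltrBlDr ltrDl.
Qed.

(** Countability of the alphabet enters here: an arbitrary set of letters gives a countable union of
    one-coordinate cylinders. *)
Lemma coord_measurable (i : int) (B : set A) :
  measurable ([set w | B (w i)] : set (biseq A)).
Proof.
have -> : [set w : biseq A | B (w i)]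
  = \bigcup_(m in [set m | B (decode m)]) [set w | code (w i) = m].
  apply/seteqP; split=> w /=; first by move=> Bw; exists (code (w i)); rewrite //= codeK.
  by move=> [m /= Bm cm]; move: Bm; rewrite -cm codeK.
apply: bigcup_measurable => m _.
have [e|ne] := eqVneq (code (decode m)) m; last first.
  rewrite (_ : [set _ | _] = set0)//; apply/seteqP; split=> // w /= cw.
  by move: ne; rewrite -cw codeK ?eqxx.
apply: sub_sigma_algebra; exists [:: i], (fun=> decode m); apply/seteqP; split=> w /=.
  by move=> cw j; rewrite inE => /eqP->; rewrite -cw codeK.
by move=> /(_ i) ->; rewrite ?inE.
Qed.

Lemma past_sigma_measurable n (E : set (biseq A)) : past_sigma n E -> measurable E.
Proof.
apply: smallest_sub; first exact: sigma_algebra_measurable.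
by move=> _ [i [B [_ ->]]]; exact: coord_measurable.
Qed.

Lemma measurable_prefix_code n N :
  measurable_fun [set: biseq A] (fun w : biseq A => prefix_code N (past_before n w)).
Proof.
move=> _ B _; rewrite setTI.
have -> : (fun w : biseq A => prefix_code N (past_before n w)) @^-1` B
  = \bigcup_(m in B) [set w | prefix_code N (past_before n w) = m].
  by apply/seteqP; split=> w /=; [move=> Bw; eexists; first exact: Bw|move=> [m Bm] /= ->].
apply: bigcup_measurable => m _; apply: (@past_sigma_measurable n).
exact: past_sigma_prefix_code.
Qed.

(** A dominated function is a pointwise limit of functions of [prefix_code], and these are
    measurable because the code takes values in [nat]. *)
Lemma measurable_past_fun c C h n : (fun N => \sum_(j < N) c j) @ \oo --> C ->
  osc_dominated c C h ->
  measurable_fun [set: biseq A] (fun w : biseq A => h (past_before n w)).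
Proof.
move=> cC hc.
apply: (measurable_fun_cvg (h := fun N (w : biseq A) =>
  h (prefix_decode (prefix_code N (past_before n w))))).
  move=> N; have := measurable_prefix_code n N.
  exact: (@measurableT_comp _ _ _ _ _ _ (h \o prefix_decode)).
by move=> w _; exact: prefix_cvg cC hc.
Qed.

Lemma past_before_cons n (w : biseq A) :
  past_before (n + 1) w = past_cons (w n) (past_before n w).
Proof.
apply/funext => -[|k] /=; rewrite /past_before; first by rewrite addrK.
by congr w; rewrite -[k.+2]addn1 PoszD opprD addrACA subrr addr0.
Qed.

End past_sigma_algebra.

(** * From conditional probabilities to integrals against the kernel *)

Section conditioning.
Context {R : realType} {A : pointedType} (code : A -> nat) (code_inj : injective code).
Variable mu : probability (biseq A) R.
Variable g : A -> past A -> R.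
Hypotheses (g_kernel : is_kernel g) (g_continuous : forall a : A, continuous (g a))
  (mu_g : compatible mu g).
Variables (b : nat -> R) (s : R).
Hypotheses (b_ge0 : forall j, 0 <= b j)
  (b_cvg : (fun N => \sum_(j < N) b j) @ \oo --> s)
  (Osc_b : forall j, (Osc g j.+1 <= (b j)%:E)%E).
Implicit Types (x y : past A) (h : past A -> R) (c : nat -> R) (C : R).
Local Notation decode := (decode code).
Local Notation past_sigma n := (@coord_sigma A [set i : int | i < n]).

(** The variation at a single letter is at most the sum over all letters, which is twice the total
    variation distance: hence the factor 2. *)
Lemma kernel_dominated a : osc_dominated (fun j => 2 * b j) (2 * s) (g a).
Proof.
move=> N x y; rewrite -mulr_sumr -mulrBr -ler_pdivrMl//.
have := tv_kernel_pmf_le code_inj g_continuous b_ge0 b_cvg Osc_b N x y.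
rewrite -lee_fin; apply: le_trans; rewrite EFinM lee_wpmul2l//.
rewrite ge0_integral_count//.
rewrite (@nneseriesD1 _ _ (code a))//.
rewrite -[leLHS]adde0; apply: leeD; last exact: nneseries_ge0.
by rewrite /kernel_pmf codeK// eqxx.
Qed.

Lemma measurable_kernel n a :
  measurable_fun [set: biseq A] (fun w : biseq A => g a (past_before n w)).
Proof.
apply: (measurable_past_fun code_inj (c := fun j => 2 * b j) (C := 2 * s)).
  by under eq_fun do rewrite -mulr_sumr; exact: cvgMr.
exact: kernel_dominated.
Qed.

(** The version of the conditional probability given by compatibility can be replaced by [g] itself,
    which is measurable and agrees with it almost everywhere. *)
Lemma cond_prob_kernel n a (E : set (biseq A)) : past_sigma n E ->
  (\int[mu]_(w in E) (g a (past_before n w))%:E = mu ([set w | w n = a] `&` E))%E.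
Proof.
move=> sE; have [h [[_ ih hE] hg]] := mu_g n a.
have mE := past_sigma_measurable code_inj sE.
rewrite -hE//; apply: ae_eq_integral => //.
- by apply/measurable_EFinP; apply: measurable_funTS; exact: measurable_kernel.
- by apply: measurable_funTS; case/integrableP : ih.
by apply: filterS hg => w -> _.
Qed.

Lemma kernel_ge0 a x : 0 <= g a x.
Proof. by have /andP[] := g_kernel.1 a x. Qed.

Lemma kernel_le1 a x : g a x <= 1.
Proof. by have /andP[] := g_kernel.1 a x. Qed.

Lemma ge0_integral_fibers (e : biseq A -> nat) (D : set (biseq A)) (phi : biseq A -> \bar R) :
  measurable D -> measurable_fun [set: biseq A] e ->
  measurable_fun [set: biseq A] phi -> (forall w, 0 <= phi w)%E ->
  (\int[mu]_(w in D) phi w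
   = \sum_(0 <= m <oo) \int[mu]_(w in D `&` [set w | e w = m]) phi w)%E.
Proof.
move=> mD me mphi phi0.
have mF m : measurable (D `&` [set w | e w = m]).
  apply: measurableI => //; rewrite -[X in measurable X]setTI.
  exact: (me measurableT [set m]).
have DE : D = \bigcup_m (D `&` [set w | e w = m]).
  by apply/seteqP; split=> w; [move=> Dw; exists (e w)|move=> [m _ []]].
rewrite {1}DE ge0_integral_bigcup//.
- exact: measurable_funTS.
- by apply/trivIsetP => i j _ _ ij; apply/seteqP; split => // w [[_ /= ->] [_ /= eij]];
    move: ij; rewrite eij eqxx.
Qed.

(** On each fiber of the prefix code the factor [eta] is constant, so the identity reduces to
    [cond_prob_kernel] there. *)
Lemma integral_cylinder_fun n a N (eta : nat -> R) : (forall m, 0 <= eta m) ->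
  let e := fun w : biseq A => prefix_code code N (past_before n w) in
  (\int[mu]_(w in [set w | w n = a]) (eta (e w))%:E
   = \int[mu]_w (g a (past_before n w) * eta (e w))%:E)%E.
Proof.
move=> eta0 e; have me : measurable_fun [set: biseq A] e.
  exact: measurable_prefix_code.
have meta : measurable_fun [set: biseq A] (eta \o e) by exact: measurableT_comp.
have ma : measurable ([set w | w n = a] : set (biseq A)).
  exact: (coord_measurable code_inj n [set a]).
have mg := measurable_kernel n a.
rewrite (ge0_integral_fibers (e := e))//; first last.
- by move=> w; rewrite lee_fin.
- exact/measurable_EFinP.
rewrite [RHS](ge0_integral_fibers (e := e))//; first last.
- by move=> w; rewrite lee_fin mulr_ge0// kernel_ge0.
- by apply/measurable_EFinP; exact: measurable_funM.
apply: eq_eseriesr => m _; rewrite setTI.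
have se : past_sigma n [set w | e w = m] by exact: past_sigma_prefix_code.
have mE := past_sigma_measurable code_inj se.
transitivity ((eta m)%:E * mu ([set w | w n = a] `&` [set w | e w = m]))%E.
  rewrite -integral_cst//; last exact: measurableI.
  by apply: eq_integral => w; rewrite inE => -[_ /= ->].
rewrite -(cond_prob_kernel a se) -ge0_integralZl_EFin//.
- by apply: eq_integral => w; rewrite inE /= => ->; rewrite mulrC EFinM.
- by move=> w _; rewrite lee_fin kernel_ge0.
- by apply/measurable_EFinP; exact: measurable_funTS.
Qed.

Lemma integral_coord_past n a c C h : (fun N => \sum_(j < N) c j) @ \oo --> C ->
  osc_dominated c C h -> (forall x, 0 <= h x) ->
  (\int[mu]_(w in [set w | w n = a]) (h (past_before n w))%:E
   = \int[mu]_w (g a (past_before n w) * h (past_before n w))%:E)%E.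
Proof.
move=> cC hc h0; have [M [M0 hM]] := osc_dominated_bounded hc.
pose hN N (w : biseq A) := h (prefix_decode code (prefix_code code N (past_before n w))).
have mhN N : measurable_fun [set: biseq A] (hN N).
  apply: (measurableT_comp (f := h \o prefix_decode code)) => //.
  exact: measurable_prefix_code.
have mh := measurable_past_fun code_inj n cC hc.
have ma : measurable ([set w | w n = a] : set (biseq A)).
  exact: (coord_measurable code_inj n [set a]).
have mg := measurable_kernel n a.
have int_cst (D : set (biseq A)) : measurable D -> mu.-integrable D (cst M%:E).
  move=> mD; apply/integrableP; split => //.
  rewrite integral_cst//= ltey_eq fin_numM//; exact: fin_num_measure.
(* Dominated convergence from prefixes to full pasts, stated once for both sides: the left has
   [f = 1] on [[set w | w n = a]], the right has [f = g a] on the whole space. *)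
have cv (D : set (biseq A)) (f : biseq A -> R) : measurable D ->
    measurable_fun [set: biseq A] f -> (forall w, 0 <= f w <= 1) ->
    (fun N => \int[mu]_(w in D) (f w * hN N w)%:E)%E @ \oo -->
    (\int[mu]_(w in D) (f w * h (past_before n w))%:E)%E.
  move=> mD mf f01.
  apply: (@dominated_cvg _ _ _ _ _ mD _ _ (cst M%:E)).
  - move=> N; apply/measurable_EFinP; apply: measurable_funTS.
    exact: measurable_funM.
  - move=> w _; apply: cvg_EFin; first exact: nearW.
    by apply: cvgMr; exact: prefix_cvg cC hc.
  - by [].
  - exact: int_cst.
  - move=> N w _; rewrite lee_fin normrM /=.
    have /andP[f0 f1] := f01 w; rewrite ger0_norm// -[leRHS]mul1r.
    by rewrite ler_pM//; exact: hM.
have cl := cv [set w | w n = a] (cst 1) ma (measurable_cst _).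
have /cl {cl} : forall w : biseq A, 0 <= (cst 1 w : R) <= 1 by move=> w /=; rewrite ler01 lexx.
have := cv [set: biseq A] (fun w => g a (past_before n w)) measurableT mg.
have g01 (w : biseq A) : 0 <= g a (past_before n w) <= 1.
  by rewrite kernel_ge0 kernel_le1.
move=> /(_ g01) cr cl.
have eqN : (fun N => \int[mu]_(w in [set w | w n = a]) (cst 1 w * hN N w)%:E)%E
    = (fun N => \int[mu]_w (g a (past_before n w) * hN N w)%:E)%E.
  apply/funext => N; rewrite -[RHS](@integral_cylinder_fun n a N (h \o prefix_decode code)).
    by apply: eq_integral => w _; rewrite mul1r.
  by move=> m; exact: h0.
rewrite eqN in cl; have <- := cvg_unique _ cl cr; last exact: ereal_hausdorff.
by apply: eq_integral => w _; rewrite mul1r.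
Qed.

Lemma kernel_op_series c C h x : osc_dominated c C h -> (forall x, 0 <= h x) ->
  ((kernel_op code g h x)%:E
   = \sum_(0 <= m <oo) (kernel_pmf code g x m * h (past_cons (decode m) x))%:E)%E.
Proof.
move=> hc h0; have [M [M0 hM]] := osc_dominated_bounded hc.
have kp := kernel_pmfP code_inj g_kernel x.
rewrite /kernel_op /pexp /Rintegral fineK; last first.
  apply: integrable_fin_num => //.
  exact: (integrable_mul_bounded (M := M) (pmf_integrable kp)).
by rewrite ge0_integral_count// => m; rewrite lee_fin mulr_ge0// kp.1.
Qed.

(** The integral is cut according to the letter at [n], each piece is conditioned on the past of
    [n], and the pieces are summed under the integral, which nonnegativity permits. *)
Lemma integral_kernel_op_ge0 n c C h : (fun N => \sum_(j < N) c j) @ \oo --> C ->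
  osc_dominated c C h -> (forall x, 0 <= h x) ->
  (\int[mu]_w (h (past_before (n + 1) w))%:E
   = \int[mu]_w (kernel_op code g h (past_before n w))%:E)%E.
Proof.
move=> cC hc h0.
pose hm m := h \o past_cons (decode m).
have cC1 : (fun N => \sum_(j < N) c j.+1) @ \oo --> C - c 0%N.
  exact: sum_shift_cvg.
have hmc m := osc_dominated_cons (decode m) hc.
have mhm m := measurable_past_fun code_inj n cC1 (hmc m).
have mcode : measurable_fun [set: biseq A] (fun w : biseq A => code (w n)).
  move=> _ B _; rewrite setTI.
  exact: (coord_measurable code_inj n (code @^-1` B)).
rewrite (ge0_integral_fibers (e := fun w => code (w n)))//; first last.
- by move=> w; rewrite lee_fin.
- by apply/measurable_EFinP; exact: (measurable_past_fun code_inj _ cC hc).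
under [RHS]eq_integral do rewrite (kernel_op_series _ hc h0).
have wt0 x m : 0 <= kernel_pmf code g x m.
  by rewrite /kernel_pmf; case: ifP => // _; exact: kernel_ge0.
rewrite integral_nneseries//; first last.
- by move=> m w _; rewrite lee_fin mulr_ge0.
- move=> m; apply/measurable_EFinP; apply: measurable_funM; last exact: mhm.
  rewrite /kernel_pmf; case: (code (decode m) == m); last exact: measurable_cst.
  exact: measurable_kernel.
apply: eq_eseriesr => m _; rewrite setTI.
have [e|ne] := eqVneq (code (decode m)) m; last first.
  rewrite (_ : [set w : biseq A | _] = set0); last first.
    by apply/seteqP; split => // w /= cw; move: ne; rewrite -cw codeK ?eqxx.
  rewrite integral_set0 integral0_eq// => w _.
  by rewrite /kernel_pmf (negbTE ne) mul0r.
have -> : [set w : biseq A | code (w n) = m] = [set w | w n = decode m].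
  by apply/seteqP; split=> w /=; [move=> <-; rewrite codeK|move=> ->].
transitivity (\int[mu]_(w in [set w | w n = decode m]) (hm m (past_before n w))%:E)%E.
  by apply: eq_integral => w; rewrite inE /= => wn; rewrite past_before_cons wn.
rewrite (integral_coord_past _ cC1 (hmc m)); last by move=> x; exact: h0.
by apply: eq_integral => w _; rewrite /kernel_pmf e eqxx.
Qed.

End conditioning.

(** * Concentration *)

Section bounded_expectation.
Context {d} {T : measurableType d} {R : realType} (P : probability T R).
Implicit Types (X : T -> R).

Lemma integrable_bounded X M : measurable_fun [set: T] X -> (forall w, `|X w| <= M) ->
  P.-integrable [set: T] (EFin \o X).
Proof.
move=> mX XM; apply: measurable_bounded_integrable => //.
  by apply: le_lt_trans (probability_le1 P measurableT) _; rewrite ltry.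
exists M; split; first exact: num_real.
by move=> x Mx w _ /=; rewrite (le_trans (XM w)) ?ltW.
Qed.

Lemma Rintegral_prob_cst r : \int[P]_w r = r.
Proof. by rewrite Rintegral_cst// [X in fine X](probability_setT P) mulr1. Qed.

Lemma Rintegral_addl X M r : measurable_fun [set: T] X -> (forall w, `|X w| <= M) ->
  \int[P]_w (r + X w) = r + \int[P]_w X w.
Proof.
move=> mX XM; rewrite RintegralD//; last exact: integrable_bounded XM.
  by rewrite Rintegral_prob_cst.
exact: (@integrable_bounded (cst r) `|r|).
Qed.

Lemma Rintegral_bounds X l u : measurable_fun [set: T] X ->
  (forall w, l <= X w <= u) -> l <= \int[P]_w X w <= u.
Proof.
move=> mX lXu.
have XM w : `|X w| <= `|l| + `|u|.
  have /andP[h1 h2] := lXu w; rewrite ler_norml.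
  have := ler_norm l; have := ler_norm u; have := ler_norm (- l); have := normr_ge0 l.
  by rewrite normrN; have := normr_ge0 u; lra.
have iX := integrable_bounded mX XM.
have ic (r : R) : P.-integrable [set: T] (EFin \o cst r).
  exact: (@integrable_bounded (cst r) `|r|).
have cE (r : R) : r = \int[P]_w (cst r w) by rewrite Rintegral_prob_cst.
apply/andP; split.
  by rewrite [leLHS]cE; apply: le_Rintegral => // w _; have /andP[] := lXu w.
by rewrite [leRHS]cE; apply: le_Rintegral => // w _; have /andP[] := lXu w.
Qed.

Lemma measurable_superlevel X (u : R) (sg : bool) : measurable_fun [set: T] X ->
  measurable [set w | X w \in Interval (BSide sg u) +oo%O].
Proof.
move=> mX; rewrite -[X in measurable X]setTI.
exact: (mX measurableT [set` Interval (BSide sg u) +oo%O]).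
Qed.

Lemma chernoff_half X V u : measurable_fun [set: T] X -> 0 < V -> 0 < u ->
  (forall t : R, 'E_P[fun w => expR (t * X w)%R] <= (expR (t ^+ 2 * V / 8))%:E)%E ->
  (P [set w | (u < X w)%R] <= (expR (- (2 * u ^+ 2 / V)))%:E)%E.
Proof.
(* This [t] minimizes [t ^+ 2 * V / 8 - t * u], with minimum [- (2 * u ^+ 2 / V)]. *)
move=> mX V0 u0 mgf; pose t := 4 * u / V.
have t0 : 0 < t by rewrite divr_gt0// mulr_gt0.
pose Y : {RV P >-> R} := mfun_Sub (mem_set mX).
have := @chernoff _ _ _ P Y t u t0.
have -> : 'M_P Y t = ('E_P[fun w => expR (t * X w)%R])%E.
  by rewrite /mmt_gen_fun; congr expectation.body; apply/funext => w /=; rewrite mulrC.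
move=> ch; apply: (@le_trans _ _ (P [set w | (u <= X w)%R])).
  apply: le_measure; rewrite ?inE.
  - have := measurable_superlevel u false mX; congr measurable.
    by apply/seteqP; split=> w /=; rewrite in_itv/= andbT.
  - have := measurable_superlevel u true mX; congr measurable.
    by apply/seteqP; split=> w /=; rewrite in_itv/= andbT.
  - by move=> w /= /ltW.
apply: (le_trans ch); apply: (@le_trans _ _ ((expR (t ^+ 2 * V / 8))%:E * (expR (- (t * u)))%:E)%E).
  by rewrite lee_wpmul2r// lee_fin expR_ge0.
rewrite -EFinM -expRD lee_fin ler_expR /t le_eqVlt; apply/orP; left; apply/eqP.
by field; rewrite gt_eqF.
Qed.

Lemma subgaussian_tail X V u : measurable_fun [set: T] X -> 0 < V -> 0 < u ->
  (forall t : R, 'E_P[fun w => expR (t * X w)%R] <= (expR (t ^+ 2 * V / 8))%:E)%E ->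
  (P [set w | (u < `|X w|)%R] <= 2%:E * (expR (- (2 * u ^+ 2 / V)))%:E)%E.
Proof.
move=> mX V0 u0 mgf.
have mNX : measurable_fun [set: T] (\- X) by exact: measurableT_comp.
have mgfN (t : R) : ('E_P[fun w => expR (t * (\- X) w)%R] <= (expR (t ^+ 2 * V / 8))%:E)%E.
  rewrite -sqrrN; apply: le_trans (mgf (- t)); rewrite le_eqVlt; apply/orP; left; apply/eqP.
  by congr expectation.body; apply/funext => w /=; rewrite mulrN mulNr.
have h1 := chernoff_half mX V0 u0 mgf.
have h2 := chernoff_half mNX V0 u0 mgfN.
have meas (Z : T -> R) : measurable_fun [set: T] Z -> measurable [set w | (u < Z w)%R].
  move=> mZ; have := measurable_superlevel u false mZ; congr measurable.
  by apply/seteqP; split=> w /=; rewrite in_itv/= andbT.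
have -> : [set w | (u < `|X w|)%R] = [set w | (u < X w)%R] `|` [set w | (u < (\- X) w)%R].
  by apply/seteqP; split=> w /=; rewrite ltr_normr; [move/orP|move=> /orP].
have /le_trans := measureU2 P (meas _ mX) (meas _ mNX); apply.
have -> : 2%:E = (1 + 1)%E :> \bar R by rewrite -EFinD.
by rewrite ge0_muleDl// !mul1e leeD.
Qed.

End bounded_expectation.

(** * Iteration of the kernel operator under a compatible measure *)

Section concentration.
Context {R : realType} {A : pointedType} (code : A -> nat) (code_inj : injective code).
Variable mu : probability (biseq A) R.
Variable g : A -> past A -> R.
Hypotheses (g_kernel : is_kernel g) (g_continuous : forall a : A, continuous (g a))
  (mu_g : compatible mu g).
Variables (b : nat -> R) (s : R).
Hypotheses (b_ge0 : forall j, 0 <= b j) (s_lt1 : s < 1)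
  (b_cvg : (fun N => \sum_(j < N) b j) @ \oo --> s)
  (Osc_b : forall j, (Osc g j.+1 <= (b j)%:E)%E).
Implicit Types (x y : past A) (h : past A -> R) (c : nat -> R) (C t : R).
Local Notation kop := (kernel_op code g).
Local Notation D c k := (iter k (osc_step b) c 0%N).

(** A bounded [h] is made nonnegative by adding [M]; the operator fixes constants, so [M]
    cancels. *)
Lemma Rintegral_kernel_op n c C h : (fun N => \sum_(j < N) c j) @ \oo --> C ->
  (forall j, 0 <= c j) -> osc_dominated c C h ->
  \int[mu]_w h (past_before (n + 1) w) = \int[mu]_w kop h (past_before n w).
Proof.
move=> cC c0 hc; have [M [M0 hM]] := osc_dominated_bounded hc.
have kc := kernel_op_dominated code_inj g_kernel g_continuous b_ge0 b_cvg Osc_b c0 cC hc.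
have kcC := osc_step_cvg b_cvg cC.
have Mh0 x : 0 <= M + h x by have := hM x; rewrite ler_norml; lra.
have := integral_kernel_op_ge0 code_inj g_kernel g_continuous mu_g b_ge0 b_cvg Osc_b n
  cC (osc_dominated_addl M hc) Mh0.
have kE x : kop (fun x => M + h x) x = M + kop h x.
  have := kernel_op_affine code_inj g_kernel M 1 x hM; rewrite mul1r => <-.
  by congr (kop _ x); apply/funext => z; rewrite mul1r.
under [in RHS]eq_integral do rewrite kE.
move=> /(congr1 fine); rewrite -!/(Rintegral _ _ _).
have m1 := measurable_past_fun code_inj (n + 1) cC hc.
have m2 := measurable_past_fun code_inj n kcC kc.
rewrite (@Rintegral_addl _ _ _ mu (fun w => h (past_before (n + 1) w)) M)//.
rewrite (@Rintegral_addl _ _ _ mu (fun w => kop h (past_before n w)) M)//.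
  exact: addrI.
by move=> w; exact: kernel_op_bounded.
Qed.

Variables (c : nat -> R) (C : R) (h : past A -> R).
Hypotheses (c_ge0 : forall j, 0 <= c j) (c_cvg : (fun N => \sum_(j < N) c j) @ \oo --> C)
  (h_dom : osc_dominated c C h).

(** Total oscillation after [m] steps: step [k] removes the leading term [D c k] and gives back [s]
    times it. *)
Let osc_left m := C - (1 - s) * \sum_(k < m) D c k.

Lemma iter_kernel_op_dominated m :
  (fun N => \sum_(j < N) iter m (osc_step b) c j) @ \oo --> osc_left m /\
  osc_dominated (iter m (osc_step b) c) (osc_left m) (iter m kop h).
Proof.
elim: m => [|m [IH1 IH2]]; first by rewrite /osc_left big_ord0 mulr0 subr0.
have -> : osc_left m.+1 = osc_left m - D c m + D c m * s.
  by rewrite /osc_left big_ord_recr /=; ring.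
split; first exact: osc_step_cvg.
apply: kernel_op_dominated => // j; exact: iter_osc_step_ge0.
Qed.

Lemma Rintegral_iter_kernel_op n m :
  \int[mu]_w h (past_before n w) = \int[mu]_w iter m kop h (past_before (n - m%:Z) w).
Proof.
elim: m => [|m IH]; first by under [RHS]eq_Rintegral do rewrite subr0.
have [cv dom] := iter_kernel_op_dominated m.
rewrite IH; have -> : n - m%:Z = (n - m.+1%:Z) + 1 by rewrite -addn1 PoszD opprD addrA subrK.
by apply: Rintegral_kernel_op cv _ dom => j; exact: iter_osc_step_ge0.
Qed.

(** Iteration preserves the mean, and the [m]-th iterate varies by at most [osc_left m], hence stays
    that close to its mean everywhere. *)
Lemma iter_kernel_op_mean n m x :
  `|iter m kop h x - \int[mu]_w h (past_before n w)| <= osc_left m.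
Proof.
have [cv dom] := iter_kernel_op_dominated m.
rewrite (Rintegral_iter_kernel_op n m).
have mk := measurable_past_fun code_inj (n - m%:Z) cv dom.
have : iter m kop h x - osc_left m <= \int[mu]_w iter m kop h (past_before (n - m%:Z) w)
    <= iter m kop h x + osc_left m.
  apply: Rintegral_bounds => // w.
  have := osc_dominated_dist x (past_before (n - m%:Z) w) dom; rewrite ler_norml; lra.
by rewrite ler_norml; lra.
Qed.

(** Each step moves the time back by one and releases one Hoeffding factor, governed by the current
    leading oscillation. *)
Lemma mgf_iter_kernel_op n m t :
  (\int[mu]_w (expR (t * h (past_before n w)))%:E
   <= (expR (t ^+ 2 / 8 * \sum_(k < m) D c k ^+ 2))%:E
      * \int[mu]_w (expR (t * iter m kop h (past_before (n - m%:Z) w)))%:E)%E.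
Proof.
elim: m => [|m IH].
  rewrite big_ord0 mulr0 expR0 mul1e.
  by under [leRHS]eq_integral do rewrite subr0.
apply: (le_trans IH).
have [cv dom] := iter_kernel_op_dominated m.
have [cv' dom'] := iter_kernel_op_dominated m.+1.
have d0 j := iter_osc_step_ge0 m j b_ge0 c_ge0.
have [M [M0 hM]] := osc_dominated_bounded dom.
have [M' [M'0 hM']] := osc_dominated_bounded dom'.
have edom := osc_dominated_expR t hM dom.
have edom' := osc_dominated_expR t hM' dom'.
have ecv (r : R) c' C' : (fun N => \sum_(j < N) c' j) @ \oo --> C' ->
    (fun N => \sum_(j < N) r * c' j) @ \oo --> r * C'.
  by move=> cv0; under eq_fun do rewrite -mulr_sumr; exact: cvgMr.
rewrite big_ord_recr /= mulrDr expRD EFinM -muleA lee_wpmul2l ?lee_fin ?expR_ge0//.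
have -> : n - m%:Z = (n - m.+1%:Z) + 1 by rewrite -addn1 PoszD opprD addrA subrK.
rewrite (integral_kernel_op_ge0 code_inj g_kernel g_continuous mu_g b_ge0 b_cvg Osc_b _
  (ecv _ _ _ cv) edom)//.
have mexp := measurable_past_fun code_inj (n - m.+1%:Z) (ecv _ _ _ cv') edom'.
rewrite -ge0_integralZl_EFin//; first last.
- by apply/measurable_EFinP.
apply: ge0_le_integral => //.
- move=> w _; rewrite (kernel_op_series _ _ _ edom)//; apply: nneseries_ge0 => k _ _.
  by rewrite lee_fin mulr_ge0// (kernel_pmfP code_inj g_kernel _).1.
- have kdom := kernel_op_dominated code_inj g_kernel g_continuous b_ge0 b_cvg Osc_b _
    (ecv _ _ _ cv) edom.
  apply/measurable_EFinP.
  apply: (measurable_past_fun code_inj _ (osc_step_cvg b_cvg (ecv _ _ _ cv))).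
  by apply: kdom => j; rewrite !mulr_ge0 ?expR_ge0.
- by apply/measurable_EFinP; apply: measurable_funM.
- move=> w _; rewrite -EFinM lee_fin -expRD.
  apply: le_trans (kernel_op_expR_le code_inj g_kernel t _ d0 cv dom) _.
  by rewrite ler_expR addrC mulrAC.
Qed.

Lemma mgf_le n t Q : (forall m, \sum_(k < m) c k ^+ 2 <= Q) ->
  (\int[mu]_w (expR (t * (h (past_before n w) - \int[mu]_w h (past_before n w))))%:E
   <= (expR (t ^+ 2 * ((1 - s) ^- 2 * Q) / 8))%:E)%E.
Proof.
move=> cQ; set mean := \int[mu]_w h (past_before n w); set V := (1 - s) ^- 2 * Q.
have e0 : 0 < (1 - s) ^+ 2 by rewrite exprn_gt0// subr_gt0.
have DV m : \sum_(k < m) D c k ^+ 2 <= V.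
  rewrite /V mulrC ler_pdivlMr// mulrC; apply: le_trans (cQ m).
  exact: sqr_sum_osc_step_le (sum_ord_le_lim b_ge0 b_cvg).
(* After [m] steps the remaining exponential is replaced by that of the mean, at the price
   [|t| * osc_left m], which vanishes as [m] grows. *)
have bound m : (\int[mu]_w (expR (t * (h (past_before n w) - mean)))%:E
   <= (expR (t ^+ 2 * V / 8 + `|t| * osc_left m))%:E)%E.
  have [cv dom] := iter_kernel_op_dominated m.
  have [M [M0 hM]] := osc_dominated_bounded h_dom.
  have [M' [M'0 hM']] := osc_dominated_bounded dom.
  have ecv (r : R) c' C' : (fun N => \sum_(j < N) c' j) @ \oo --> C' ->
      (fun N => \sum_(j < N) r * c' j) @ \oo --> r * C'.
    by move=> cv0; under eq_fun do rewrite -mulr_sumr; exact: cvgMr.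
  have me := measurable_past_fun code_inj n (ecv _ _ _ c_cvg) (osc_dominated_expR t hM h_dom).
  have me' := measurable_past_fun code_inj (n - m%:Z) (ecv _ _ _ cv) (osc_dominated_expR t hM' dom).
  have -> : (\int[mu]_w (expR (t * (h (past_before n w) - mean)))%:E
      = (expR (- (t * mean)))%:E * \int[mu]_w (expR (t * h (past_before n w)))%:E)%E.
    rewrite -ge0_integralZl_EFin//; last by apply/measurable_EFinP.
    by apply: eq_integral => w _; rewrite -EFinM -expRD mulrBr addrC.
  apply: (@le_trans _ _ ((expR (- (t * mean)))%:E * ((expR (t ^+ 2 / 8 * V))%:E *
      (expR (t * mean + `|t| * osc_left m))%:E))%E).
    rewrite lee_wpmul2l ?lee_fin ?expR_ge0//.
    apply: le_trans (mgf_iter_kernel_op n m t) _; apply: lee_pmul => //.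
    - by apply: integral_ge0 => w _; rewrite lee_fin expR_ge0.
    - by rewrite lee_fin ler_expR ler_wpM2l// divr_ge0 ?sqr_ge0.
    rewrite -[leRHS]mule1 -(@probability_setT _ _ _ mu) -integral_cst//.
    apply: ge0_le_integral => //.
    - exact/measurable_EFinP.
    - move=> w _; rewrite lee_fin ler_expR.
      rewrite -lerBlDl -mulrBr (le_trans (ler_norm _))// normrM ler_wpM2l//.
      exact: iter_kernel_op_mean.
  by rewrite -!EFinM -!expRD lee_fin ler_expR; lra.
have cv : (fun m => expR (t ^+ 2 * V / 8 + `|t| * osc_left m)) @ \oo -->
    expR (t ^+ 2 * V / 8 + `|t| * 0).
  apply: continuous_cvg; first exact: continuous_expR.
  apply: cvgD; first exact: cvg_cst.
  by apply: cvgMr; exact: osc_left_cvg0.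
rewrite mulr0 addr0 in cv.
set I := (\int[mu]_w _)%E in bound *.
have I0 : (0 <= I)%E by apply: integral_ge0 => w _; rewrite lee_fin expR_ge0.
have If : I \is a fin_num by rewrite ge0_fin_numE// (le_lt_trans (bound 0%N))// ltry.
rewrite -(fineK If) lee_fin -(cvg_lim _ cv)//; apply: limr_ge.
  by apply/cvg_ex; eexists; exact: cv.
by apply: nearW => m; rewrite -lee_fin fineK.
Qed.

End concentration.

(** * The oscillations of the kernel as a summable real sequence *)

Section oscillation_coefficients.
Context {R : realType} {A : pointedType} (g : A -> past A -> R).

Lemma Osc_ge0 j : (0 <= Osc g j)%E.
Proof.
apply: ereal_sup_ubound; exists (fun=> point, fun=> point) => //=.
by rewrite esum1 ?mule0// => a _; rewrite subrr normr0.
Qed.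

Hypothesis Delta_gt0 : (0 < Delta g)%E.
Let S : \bar R := (\sum_(1 <= j <oo) Osc g j)%E.

Let S_ge0 : (0 <= S)%E. Proof. by apply: nneseries_ge0 => j _ _; exact: Osc_ge0. Qed.

(** An infinite sum would make [Delta g] equal to [-oo], against its positivity. *)
Let S_fin : S \is a fin_num.
Proof.
rewrite ge0_fin_numE// ltNge leye_eq; apply/negP => /eqP SE.
by move: Delta_gt0; rewrite /Delta -/S SE.
Qed.

Lemma Delta_fineE : fine (Delta g) = 1 - fine S.
Proof. by rewrite /Delta -/S -(fineK S_fin). Qed.

Lemma Delta_fineK : (fine (Delta g))%:E = Delta g.
Proof. by rewrite fineK// fin_numB S_fin. Qed.

Lemma Osc_fineK j : (fine (Osc g j.+1))%:E = Osc g j.+1.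
Proof.
rewrite fineK// ge0_fin_numE ?Osc_ge0//; apply: (@le_lt_trans _ _ S); last first.
  by rewrite ltey_eq S_fin.
apply: le_trans (nneseries_lim_ge j.+2 _); last by move=> i _ _; exact: Osc_ge0.
by rewrite big_nat_recr//= leeDr// sume_ge0// => i _; exact: Osc_ge0.
Qed.

Lemma Osc_series_cvg :
  (fun N => \sum_(j < N) fine (Osc g j.+1)) @ \oo --> 1 - fine (Delta g).
Proof.
rewrite Delta_fineE opprB subrKC.
have cv : (fun N => \sum_(1 <= j < N) Osc g j)%E @ \oo --> S.
  by apply: is_cvg_ereal_nneg_natsum => j _; exact: Osc_ge0.
move: cv; rewrite -(cvg_shiftS (fun N => \sum_(1 <= j < N) Osc g j)%E) -{1}(fineK S_fin).
move=> /fine_cvg; apply: cvg_trans; apply: near_eq_cvg; apply: nearW => N /=.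
rewrite big_add1 big_mkord /=; under eq_bigr do rewrite -Osc_fineK.
by rewrite sumEFin.
Qed.

End oscillation_coefficients.

(** * Functions of finitely many coordinates, read as functions of the past *)

Section finite_functions.
Context {R : realType} {A : pointedType} {n : nat}.
Variables (f : ('I_n.+1 -> A) -> R) (f_L : in_L f).
Local Notation d i := (fine (delta f i)).

Lemma delta_ge0 i : (0 <= delta f i)%E.
Proof.
by apply: ereal_sup_ubound; exists (fun=> point), point, point; rewrite subrr normr0.
Qed.

Lemma dist_update_le (u : 'I_n.+1 -> A) i a b :
  `|f [eta u with i |-> a] - f [eta u with i |-> b]| <= d i.
Proof.
rewrite -lee_fin fineK ?ge0_fin_numE ?delta_ge0//.
by apply: ereal_sup_ubound; exists u, a, b.
Qed.

(** The path [w k] from [u] to [v] replaces one coordinate at a time, and only those where they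
    differ cost anything. *)
Lemma dist_le_sum_delta (u v : 'I_n.+1 -> A) :
  `|f u - f v| <= \sum_(i | u i != v i) d i.
Proof.
pose w k : 'I_n.+1 -> A := fun i => if (i < k)%N then v i else u i.
have w0 : w 0%N = u by apply/funext.
have wn : w n.+1 = v by apply/funext => i; rewrite /w ltn_ord.
suff H k : (k <= n.+1)%N -> `|f u - f (w k)| <= \sum_(i | (u i != v i) && (i < k)%N) d i.
  rewrite -wn (le_trans (H _ (leqnn _)))// le_eqVlt; apply/orP; left; apply/eqP.
  by apply: eq_bigl => i; rewrite wn ltn_ord andbT.
elim: k => [_|k IH kn].
  by rewrite w0 subrr normr0 sumr_ge0// => i _; rewrite fine_ge0 ?delta_ge0.
pose i0 := Ordinal kn.
apply: le_trans (ler_distD (f (w k)) _ _) _.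
have step : `|f (w k) - f (w k.+1)| <= if u i0 != v i0 then d i0 else 0.
  have wk : w k = [eta w k with i0 |-> u i0].
    by apply/funext => i /=; case: eqVneq => // ->; rewrite /w ltnn.
  have wk1 : w k.+1 = [eta w k with i0 |-> v i0].
    apply/funext => i /=; case: eqVneq => [->|ne]; first by rewrite /w ltnSn.
    by rewrite /w ltnS leq_eqVlt (_ : (nat_of_ord i == k) = false)//; apply/negbTE.
  rewrite wk1; case: eqVneq => [e|_]; first by rewrite -e -wk subrr normr0.
  by rewrite {1}wk dist_update_le.
apply: le_trans (lerD (IH (ltnW kn)) step) _.
rewrite le_eqVlt; apply/orP; left; apply/eqP.
rewrite big_mkcond [in RHS]big_mkcond (bigD1 i0)//= [RHS](bigD1 i0)//= ltnn ltnSn.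
rewrite andbF andbT add0r addrC; congr (_ + _); apply: eq_bigr => i ne.
by rewrite ltnS [in RHS]leq_eqVlt (_ : (nat_of_ord i == k) = false)//; apply/negbTE.
Qed.

(* The value of [f] at the coordinates 0, ..., n is read off the past of n + 1,
   whose entry j is the coordinate n - j. *)
Definition past_fun (x : past A) : R := f (fun i => x (n - i)%N).

(** The oscillations of [f] in reversed order, as entry [j] is coordinate [n - j], extended by 0 to
    the entries that [f] does not see. *)
Definition past_delta (j : nat) : R := if (j <= n)%N then d (inord (n - j)) else 0.

Lemma past_fun_before (w : biseq A) : past_fun (past_before (n%:Z + 1) w) = on_biseq f w.
Proof.
congr f; apply/funext => i; congr w.
have le_in : (i <= n)%N by rewrite -ltnS.
by rewrite -[(n - i).+1]addn1 PoszD -subzn// opprD addrACA subrr addr0 opprB subrKC.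
Qed.

Lemma past_delta_ge0 j : 0 <= past_delta j.
Proof. by rewrite /past_delta; case: ifP => // _; rewrite fine_ge0 ?delta_ge0. Qed.

(** General in [F] so as to serve both the sum ([F] the identity) and the sum of squares; [F 0 = 0]
    discards the entries beyond [n]. *)
Lemma sum_past_delta_le (P : pred nat) (F : R -> R) N : F 0 = 0 ->
  (forall r, 0 <= r -> 0 <= F r) ->
  \sum_(j < N | P j) F (past_delta j) <= \sum_(j < n.+1 | P j) F (past_delta j).
Proof.
move=> F0 Fge0; have Fd j : 0 <= F (past_delta j) by rewrite Fge0 ?past_delta_ge0.
have [Nn|nN] := leqP N n.+1.
  rewrite (big_ord_widen_cond _ P (F \o past_delta) Nn).
  rewrite big_mkcond [leRHS]big_mkcond; apply: ler_sum => j _.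
  by case: (P j); case: (_ < _)%N => /=.
rewrite [leRHS](big_ord_widen_cond _ P (F \o past_delta) (ltnW nN)).
rewrite big_mkcond [leRHS]big_mkcond; apply: ler_sum => j _ /=.
case: (P j) => //=; case: ifP => // nj.
by rewrite /past_delta -ltnS nj F0.
Qed.

Lemma sum_past_deltaE (P : pred 'I_n.+1) (F : R -> R) :
  \sum_(j < n.+1 | P (rev_ord j)) F (past_delta j) = \sum_(i < n.+1 | P i) F (d i).
Proof.
rewrite [RHS](reindex_inj rev_ord_inj) /=; apply: eq_bigr => j _.
rewrite /past_delta -ltnS ltn_ord; congr (F (fine (delta f _))).
by apply/val_inj; rewrite /= inordK ?subSS// ltnS leq_subr.
Qed.

Lemma past_delta_cvg :
  (fun N => \sum_(j < N) past_delta j) @ \oo --> \sum_(i < n.+1) d i.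
Proof.
rewrite -(sum_past_deltaE predT id); apply: cvg_near_cst; exists n.+1 => // N /= nN.
apply/eqP; rewrite eq_le (@sum_past_delta_le predT id)//=.
rewrite (big_ord_widen_cond _ predT past_delta nN) big_mkcond.
by apply: ler_sum => j _; case: ifP => // _; exact: past_delta_ge0.
Qed.

Lemma past_fun_dominated : osc_dominated past_delta (\sum_(i < n.+1) d i) past_fun.
Proof.
move=> N x y; apply: le_trans (dist_le_sum_delta _ _) _.
rewrite [in leRHS](bigID (fun i : 'I_n.+1 => (x (n - i)%N : A) != y (n - i)%N)) /=.
rewrite -addrA lerDl subr_ge0.
rewrite (eq_bigl (fun j : 'I_N => (fun k : nat => (x k : A) == y k) j))//.
apply: le_trans (@sum_past_delta_le (fun k : nat => (x k : A) == y k) id N erefl _) _ => //.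
rewrite -(sum_past_deltaE (fun i => ~~ ((x (n - i)%N : A) != y (n - i)%N)) id).
rewrite le_eqVlt; apply/orP; left; apply/eqP; apply: eq_bigl => j /=.
by rewrite negbK subSS subKn// -ltnS.
Qed.

Lemma sum_sqr_past_delta_le N : \sum_(j < N) past_delta j ^+ 2 <= delta_norm2_sq f.
Proof.
rewrite /delta_norm2_sq -(sum_past_deltaE predT (fun r => r ^+ 2)).
apply: (@sum_past_delta_le predT (fun r => r ^+ 2)); first by rewrite expr0n.
by move=> r _; exact: sqr_ge0.
Qed.

End finite_functions.

Local Open Scope ereal_scope.

Theorem theorem3p2 (R : realType) (A : pointedType)
    (A_countable : countable [set: A])
    (mu : probability (biseq A) R) (g : A -> past A -> R)
    (mu_inv : shift_invariant mu)
    (g_kernel : is_kernel g)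
    (* Not implied by Delta g > 0: Osc does not see the tail of a past, and the
       conclusion fails for mixtures compatible with a tail-dependent kernel. *)
    (g_continuous : forall a : A, continuous (g a))
    (mu_g : compatible mu g)
    (Delta_gt0 : 0 < Delta g)
    (n : nat) (f : ('I_n.+1 -> A) -> R) (f_L : in_L f) :
  (forall theta : R,
     'E_mu[fun w => expR (theta * (on_biseq f w - fine 'E_mu[on_biseq f]))%R]
     <= (expR (theta ^+ 2 * fine (Delta g) ^- 2 / 8 * delta_norm2_sq f)%R)%:E)
  /\
  (* The quotient is taken in \bar R: if the norm vanishes it is +oo, and the
     bound is 0. *)
  (forall u : R, (0 < u)%R ->
     mu [set w | (u < `|on_biseq f w - fine 'E_mu[on_biseq f]|)%R]
     <= 2%:E * expeR (- ((2 * u ^+ 2)%:E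
                         / (fine (Delta g) ^- 2 * delta_norm2_sq f)%:E))).
Proof.
have /countable_injP[code code_inj'] := A_countable.
have code_inj : injective code by move=> a b; apply: code_inj'; rewrite inE.
have b_ge0 j : (0 <= fine (Osc g j.+1))%R by rewrite fine_ge0 ?Osc_ge0.
have b_cvg := Osc_series_cvg Delta_gt0.
have Osc_b j : Osc g j.+1 <= (fine (Osc g j.+1))%:E by rewrite Osc_fineK.
have Delta0 : (0 < fine (Delta g))%R.
  by rewrite -lte_fin Delta_fineK.
have s_lt1 : (1 - fine (Delta g) < 1)%R by rewrite ltrBlDr ltrDl.
have h_dom := past_fun_dominated f_L.
have mh := measurable_past_fun code_inj (n%:Z + 1) (past_delta_cvg (f := f)) h_dom.
have hE : (fun w : biseq A => past_fun f (past_before (n%:Z + 1) w)) = on_biseq f.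
  by apply/funext => w; exact: past_fun_before.
rewrite hE in mh.
set V := (fine (Delta g) ^- 2 * delta_norm2_sq f)%R.
have meanE : fine 'E_mu[on_biseq f]
    = (\int[mu]_w past_fun f (past_before (n%:Z + 1) w))%R.
  by rewrite unlock /Rintegral; under [in RHS]eq_integral do rewrite past_fun_before.
have mgf (theta : R) :
    'E_mu[fun w => expR (theta * (on_biseq f w - fine 'E_mu[on_biseq f]))%R]
    <= (expR (theta ^+ 2 * V / 8))%:E.
  have := mgf_le code_inj g_kernel g_continuous mu_g b_ge0 s_lt1 b_cvg Osc_b
    (past_delta_ge0 f) (past_delta_cvg (f := f)) h_dom (n%:Z + 1) theta (sum_sqr_past_delta_le f).
  rewrite subKr -/V -meanE unlock; apply: le_trans.
  rewrite le_eqVlt; apply/orP; left; apply/eqP; apply: eq_integral => w _.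
  by rewrite past_fun_before.
split.
  move=> theta; apply: le_trans (mgf theta) _.
  by rewrite lee_fin ler_expR /V le_eqVlt; apply/orP; left; apply/eqP; ring.
move=> u u0.
have Q0 : (0 <= delta_norm2_sq f)%R by apply: sumr_ge0 => i _; exact: sqr_ge0.
have V0 : (0 <= V)%R by rewrite mulr_ge0// invr_ge0 sqr_ge0.
(* If [V] vanishes, so do all oscillations of [f]; the case [m = 0] of [iter_kernel_op_mean] then
   shows that [f] equals its mean, and the event is empty. *)
have [Vz|Vn] := eqVneq V 0%R.
  have Qz : delta_norm2_sq f = 0%R.
    move/eqP: Vz; rewrite mulf_eq0 invr_eq0 expf_eq0/= (gt_eqF Delta0) /=.
    by move/eqP.
  have dz i : fine (delta f i) = 0%R.
    move/eqP: Qz; rewrite psumr_eq0; last by move=> j _; exact: sqr_ge0.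
    by move/allP/(_ i); rewrite mem_index_enum => /(_ isT); rewrite sqrf_eq0 => /eqP.
  rewrite [X in mu X](_ : _ = set0); first by rewrite measure0 mule_ge0// expeR_ge0.
  apply/seteqP; split=> // w /=; rewrite meanE -past_fun_before => lt_u.
  have := iter_kernel_op_mean code_inj g_kernel g_continuous mu_g b_ge0 b_cvg Osc_b
    (past_delta_ge0 f) (past_delta_cvg (f := f)) h_dom (n%:Z + 1) 0%N
    (past_before (n%:Z + 1) w).
  by rewrite big_ord0 mulr0 subr0 big1// leNgt (lt_trans u0 lt_u).
have Vp : (0 < V)%R by rewrite lt0r Vn.
have -> : (2 * u ^+ 2)%:E / V%:E = (2 * u ^+ 2 / V)%:E by rewrite inver (negbTE Vn) EFinM.
apply: (subgaussian_tail (X := fun w => (on_biseq f w - fine 'E_mu[on_biseq f])%R)) => //.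
exact: measurable_funB.
Qed.
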